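(* Let $T\in\mathbb{R}^{n+1}$ be a unit vector perpendicular to $e_{n+1}$ (so that $T$ is regarded as a vector in $\mathbb{R}^n=\mathbb{R}^n\times\{0\}$), and let $\Sigma=\{(x,u(x)) : x\in\mathbb{R}^n\}\subseteq\mathbb{R}^{n+1}$, with $u:\mathbb{R}^n\to\mathbb{R}$ smooth, be an entire graphical translator with velocity $T$. If there are positive numbers $C_1,C_2$ such that $$|u(q)|\le C_1+C_2\sqrt{|\langle q,T\rangle|}\qquad \text{for all } q\in\mathbb{R}^n,$$ then $\Sigma$ is the stationary horizontal plane, i.e. $\Sigma=\{x_{n+1}=c\}$ for some constant $c\in\mathbb{R}$.
   Context: $e_1,\dots,e_{n+1}$ is the standard basis of $\mathbb{R}^{n+1}$. The graph $\Sigma$ of a smooth function $u:\mathbb{R}^n\to\mathbb{R}$ is an entire graphical translator with velocity (direction) $T$, $T$ a unit vector, if $H=\langle\nu,T\rangle$ on $\Sigma$, where $\nu=\frac{(-Du,1)}{\sqrt{1+|Du|^2}}$ is the upward unit normal and $H=\sum_{i=1}^n D_i\left(\frac{D_iu}{\sqrt{1+|Du|^2}}\right)$ is the mean curvature. Writing $T=(T',T_{n+1})$ with $T'\in\mathbb{R}^n$, this is the equation $\sum_{i=1}^n D_i\left(\frac{D_iu}{\sqrt{1+|Du|^2}}\right)=\frac{-\langle Du,T'\rangle+T_{n+1}}{\sqrt{1+|Du|^2}}$; here $T_{n+1}=0$. *)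

(* Defs.v *)
From HB Require Import structures.
From mathcomp Require Import all_boot all_order all_algebra.
From mathcomp Require Import all_classical all_reals.
From mathcomp Require Import topology normedtype derive.

Set Implicit Arguments.
Unset Strict Implicit.
Unset Printing Implicit Defensive.

Import Order.TTheory GRing.Theory Num.Theory.
Import numFieldNormedType.Exports.

Local Open Scope classical_set_scope.
Local Open Scope ring_scope.

Definition dotv (R : realType) (n : nat) (v w : 'rV[R]_n) : R :=
  \sum_(i < n) v 0 i * w 0 i.

(* The library's norm on row vectors is the sup norm, hence a separate
   Euclidean norm.  Topology and derivatives are the same for both. *)
Definition enorm (R : realType) (n : nat) (v : 'rV[R]_n) : R :=
  Num.sqrt (dotv v v).

Definition pderiv (R : realType) (n : nat) (i : 'I_n) (f : 'rV[R]_n -> R) :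
  'rV[R]_n -> R := fun x => 'D_(delta_mx 0 i) f x.

Fixpoint Ck (R : realType) (n k : nat) (f : 'rV[R]_n -> R) : Prop :=
  if k is k'.+1 then
    continuous f /\
    forall i : 'I_n,
      (forall x, derivable f x (delta_mx 0 i)) /\ Ck k' (pderiv i f)
  else continuous f.

Definition smooth (R : realType) (n : nat) (f : 'rV[R]_n -> R) : Prop :=
  forall k : nat, Ck k f.

Definition grad (R : realType) (n : nat) (u : 'rV[R]_n -> R) (x : 'rV[R]_n) :
  'rV[R]_n := \row_(i < n) pderiv i u x.

Definition area_density (R : realType) (n : nat) (u : 'rV[R]_n -> R)
  (x : 'rV[R]_n) : R := Num.sqrt (1 + enorm (grad u x) ^+ 2).

(* Points of R^(n+1) are written (x, t) with x in R^n. *)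
Definition pt (R : realType) (n : nat) (x : 'rV[R]_n) (t : R) : 'rV[R]_(n + 1) :=
  row_mx x (const_mx t).

Definition last_coord (n : nat) : 'I_(n + 1) := rshift n ord0.

Definition graph (R : realType) (n : nat) (u : 'rV[R]_n -> R) :
  set 'rV[R]_(n + 1) := [set pt x (u x) | x in [set: 'rV[R]_n]].

Definition horizontal_plane (R : realType) (n : nat) (c : R) :
  set 'rV[R]_(n + 1) := [set p : 'rV[R]_(n + 1) | p 0 (last_coord n) = c].

(* The normal and the mean curvature of the graph at the point (x, u x). *)
Definition upward_normal (R : realType) (n : nat) (u : 'rV[R]_n -> R)
  (x : 'rV[R]_n) : 'rV[R]_(n + 1) :=
  (area_density u x)^-1 *: pt (- grad u x) 1.

Definition mean_curvature (R : realType) (n : nat) (u : 'rV[R]_n -> R)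
  (x : 'rV[R]_n) : R :=
  \sum_(i < n) pderiv i (fun y => pderiv i u y / area_density u y) x.

Definition entire_graphical_translator (R : realType) (n : nat)
  (T : 'rV[R]_(n + 1)) (u : 'rV[R]_n -> R) : Prop :=
  smooth u /\
  forall x : 'rV[R]_n, mean_curvature u x = dotv (upward_normal u x) T.

(* Main.v *)
Require Import Defs.
From HB Require Import structures.
From mathcomp Require Import all_boot all_order all_algebra.
From mathcomp Require Import all_classical all_reals.
From mathcomp Require Import topology normedtype derive realfun.
From mathcomp Require Import ring lra.

Import Order.TTheory GRing.Theory Num.Theory.
Import numFieldNormedType.Exports.

Local Open Scope classical_set_scope.
Local Open Scope ring_scope.

(** The proof consists of three applications of the maximum principle, in the
    manner of Bernstein, on balls with a quadratic cut-off.  Write [p = Du],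
    [W^2 = 1 + |p|^2] and [a = 1 - p p^T / W^2].  The translator equation is
    [Lu = 0] with [L = a_ij D_ij + D_T] ([drift_lap_u]), and every directional
    derivative of [u] solves the linearized equation, that is, it is annihilated
    by [M = W^2 L - a(D W^2, D _)] ([drift_lap_derive]).  Summing over the
    partial derivatives gives [M W^2 = 2 W^2 Q], where [Q] is a squared norm of
    the Hessian ([drift_lap_tilt2]).  This is the only second order quantity
    that occurs: derivatives of the curvature are not estimated.

    Moving a distance [r] along [T] plays the part of a time [r], during which
    diffusion covers a distance [sqrt r]; so a growth like the square root of
    the [T]-coordinate is the scale invariant one.  On a ball of radius [r], at
    least as large as the [T]-coordinate of its centre, [u] is [O(sqrt r)], and
    the following happens.

    - The gradient is bounded ([tilt2_bounded]).  A high power of a cut-off that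
      contains [u / sqrt r] is multiplied with [W^2]; at an interior maximum
      where [W] is large, the gradient of the cut-off is at least of order
      [1 / sqrt r], its image under [L] is [O(1 / r)], and the exponent makes
      the former win ([cutoff_critical]).
    - The function [f = D_T u] vanishes ([translator_stationary]).  The equation
      says that [f] is minus a trace of the Hessian, whence [f^2 <= n Q]
      ([derive_T_le]).  Therefore the term [Q] in [M W^2] absorbs all errors in
      [M (r phi^2 f^2 + A W^2)] for a cut-off [phi] and a constant [A], and this
      function has no interior maximum with [f <> 0] ([stationary_critical]).
      Hence [r f^2] is bounded at the centre, uniformly in [r].
    - Now [u] is invariant along [T], so the growth condition bounds it by its
      constant term, and a bounded [u] is constant ([bounded_translator_flat]):
      [L (u^2) = 2 (1 - 1 / W^2)] is positive wherever [W > 1], which forces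
      [W^2 + lambda u^2], corrected by a small quadratic term, to have its
      maximum where [W] is close to [1]; then [lambda] tends to [0].

    The matrix [a] is the square of a symmetric matrix.  Its columns, frozen at
    the point under consideration, form a frame along which [a_ij D_ij] is a sum
    of second derivatives in constant directions.  The maximum principle and
    the Cauchy-Schwarz inequality for [a] thereby reduce to their elementary
    versions. *)

(** * Calculus along lines *)

Lemma continuous_ball (R : realType) (V : normedModType R) (f : V -> R) (x : V)
  (e : R) : {for x, continuous f} -> 0 < e ->
  exists2 d, 0 < d & forall y, `|y - x| < d -> `|f y - f x| < e.
Proof.
move=> fx e0; move/cvgrPdist_lt: fx => /(_ e e0) /nbhs_ballP[d /= d0 dP].
exists d => // y yx; rewrite distrC; apply: dP.
by rewrite -ball_normE /= distrC.
Qed.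

Lemma is_derive_line (R : realType) (V : normedModType R) (f : V -> R)
  (x w : V) (t : R) : derivable f (x + t *: w) w ->
  is_derive t 1 (fun s : R => f (x + s *: w)) ('D_w f (x + t *: w)).
Proof.
move=> df.
have E : (fun h : R => h^-1 *: (((fun s : R => f (x + s *: w)) \o shift t) (h *: 1)
    - f (x + t *: w)))
  = (fun h => h^-1 *: ((f \o shift (x + t *: w)) (h *: w) - f (x + t *: w))).
  apply/funext => h /=.
  by rewrite [h%:A]mulr1 scalerDl addrCA.
by apply: DeriveDef; rewrite /derivable /derive /= E.
Qed.

Lemma mvt_line_pos (R : realType) (V : normedModType R) (f : V -> R) (x w : V)
  (h : R) : (forall y, derivable f y w) -> 0 < h ->
  exists c, [/\ 0 < c, c < h & f (x + h *: w) - f x = h * 'D_w f (x + c *: w)].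
Proof.
move=> df h0.
have der (t : R) : is_derive t 1 (fun s : R => f (x + s *: w)) ('D_w f (x + t *: w)).
  exact: is_derive_line.
have cont : {within `[0, h], continuous (fun s : R => f (x + s *: w))}.
  by apply: derivable_within_continuous => t _; exact: (@ex_derive _ _ _ _ _ _ _ (der t)).
have [c] := MVT h0 (fun t _ => der t) cont.
rewrite in_itv /= => /andP[c0 ch] E; exists c; split => //.
by move: E; rewrite scale0r addr0 subr0 mulrC.
Qed.

Lemma mvt_line (R : realType) (V : normedModType R) (f : V -> R) (x w : V)
  (h : R) : (forall y, derivable f y w) ->
  exists2 c, `|c| <= `|h| & f (x + h *: w) - f x = h * 'D_w f (x + c *: w).
Proof.
move=> df; have [h0|h0|->] := ltgtP h 0; last first.
- by exists 0 => //; rewrite scale0r addr0 subrr mul0r.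
- have [c [c0 ch E]] := @mvt_line_pos _ _ f x w h df h0.
  by exists c => //; rewrite !gtr0_norm // ltW.
- have h0' : 0 < - h by rewrite oppr_gt0.
  have [c [c0 ch E]] := @mvt_line_pos _ _ f (x + h *: w) w (- h) df h0'.
  exists (h + c).
    rewrite (ltr0_norm h0) ler0_norm; lra.
  move: E; rewrite -!addrA -!scalerDl subrr scale0r addr0 => E.
  by rewrite -[LHS]opprB E mulNr opprK.
Qed.

(** Only the derivative along [w] has to be continuous: the increment along
    [h *: (v + w)] is that along [h *: v] followed by one along [h *: w], and
    the latter is a value of ['D_w f] near [x]. *)
Lemma is_derive_dirD (R : realType) (V : normedModType R) (f : V -> R)
  (x v w : V) : (forall y, derivable f y w) -> {for x, continuous ('D_w f)} ->
  derivable f x v -> is_derive x (v + w) f ('D_v f x + 'D_w f x).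
Proof.
move=> dw cw dv.
suff C : (fun h => h^-1 *: ((f \o shift x) (h *: (v + w)) - f x)) @ 0^'
    --> 'D_v f x + 'D_w f x.
  apply: DeriveDef; last exact: cvg_lim C.
  by apply/cvg_ex; exists ('D_v f x + 'D_w f x).
have -> : (fun h => h^-1 *: ((f \o shift x) (h *: (v + w)) - f x)) =
  (fun h => h^-1 *: ((f \o shift x) (h *: v) - f x)) \+
  (fun h => h^-1 *: (f (x + h *: v + h *: w) - f (x + h *: v))).
  apply/funext => h /=; rewrite -scalerDr; congr (_ *: _).
  rewrite [h *: v + x]addrC scalerDr [X in f X]addrC addrA.
  by rewrite [RHS]addrC addrA subrK.
apply: (cvgD (dv : _ @ 0^' --> 'D_v f x)).
apply/cvgrPdist_lt => e e0.
have [d d0 dP] := continuous_ball _ _ _ _ e cw e0.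
have k0 : 0 < `|v| + `|w| + 1 by rewrite ltr_wpDl // addr_ge0.
exists (d / (`|v| + `|w| + 1)); first exact: divr_gt0.
move=> h /=; rewrite sub0r normrN => hd hn0.
have [c ch ->] := @mvt_line _ _ f (x + h *: v) w h dw.
rewrite /= [_ *: _]mulrA mulVf // mul1r distrC; apply: dP.
rewrite addrC !addrA addNr add0r.
apply: le_lt_trans (_ : `|h| * (`|v| + `|w| + 1) < d); last first.
  by rewrite -ltr_pdivlMr.
apply: le_trans (ler_normD _ _) _; rewrite !normrZ !mulrDr mulr1.
have := ler_wpM2r (normr_ge0 w) ch; have := normr_ge0 h; lra.
Qed.

Lemma is_derive_dirZ (R : realType) (V : normedModType R) (f : V -> R)
  (x v : V) (a : R) : derivable f x v -> is_derive x (a *: v) f (a * 'D_v f x).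
Proof.
move=> dv; have [->|a0] := eqVneq a 0.
  by rewrite scale0r mul0r; exact: is_derive0.
have dv' : derivable f (x + 0 *: v) v by rewrite scale0r addr0.
have := is_derive_line _ _ f x v 0 dv'.
rewrite scale0r addr0 => H.
have /derivable1_diffP D := @ex_derive _ _ _ _ _ _ _ H.
have E : is_derive (0 : R) (a *: (1 : R)) (fun s : R => f (x + s *: v)) (a * 'D_v f x).
  apply: DeriveDef; first exact: diff_derivable.
  rewrite deriveE // linearZ /= -deriveE //.
  by rewrite (@derive_val _ _ _ _ _ _ _ H).
have EE : (fun h : R => h^-1 *: (((fun s : R => f (x + s *: v)) \o shift 0)
    (h *: (a *: 1)) - f (x + 0 *: v)))
  = (fun h => h^-1 *: ((f \o shift x) (h *: (a *: v)) - f x)).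
  apply/funext => h /=.
  by rewrite scale0r !addr0 [a%:A]mulr1 scalerA [_ + x]addrC.
case: E => E1 E2.
apply: DeriveDef; first by move: E1; rewrite /derivable EE.
by move: E2; rewrite /derive EE.
Qed.

(** Were the second derivative positive, the first one, zero at [x], would be
    positive at the points following [x], and the mean value theorem would give
    a larger value of [f]. *)
Lemma local_max_dir (R : realType) (V : normedModType R) (f : V -> R) (x w : V)
  (d : R) : (forall y, derivable f y w) -> derivable ('D_w f) x w -> 0 < d ->
  (forall t, `|t| < d -> f (x + t *: w) <= f x) ->
  'D_w f x = 0 /\ 'D_w ('D_w f) x <= 0.
Proof.
move=> df ddf d0 fmax.
have D0 : 'D_w f x = 0.
  have := @derive1_at_max R (fun s : R => f (x + s *: w)) (- d) d 0.
  case; first by lra.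
  - by move=> t _; exact: (@ex_derive _ _ _ _ _ _ _ (is_derive_line _ _ f x w t (df _))).
  - by rewrite in_itv /=; lra.
  - move=> t; rewrite in_itv /= => /andP[t1 t2]; rewrite scale0r addr0.
    by apply: fmax; rewrite ltr_norml t1.
  - move=> _; have H := is_derive_line _ _ f x w 0 (df _).
    by rewrite (@derive_val _ _ _ _ _ _ _ H) scale0r addr0.
split => //; rewrite leNgt; apply/negP => pos.
have {}ddf : h^-1 *: (('D_w f \o shift x) (h *: w) - 'D_w f x) @[h --> 0^']
  --> 'D_w ('D_w f) x := ddf.
move/cvgrPdist_lt: ddf => /(_ _ pos) [e /= e0 eP].
pose h := Num.min d e / 2.
have m0 : 0 < Num.min d e by rewrite lt_min d0.
have [md me] : Num.min d e <= d /\ Num.min d e <= e.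
  by split; rewrite ge_min lexx ?orbT.
have h0 : 0 < h by rewrite /h; lra.
have [c [c0 ch E]] := @mvt_line_pos _ _ f x w h df h0.
have : f (x + h *: w) <= f x by apply: fmax; rewrite gtr0_norm // /h; lra.
rewrite -subr_le0 E pmulr_rle0 //; apply/negP; rewrite -ltNge.
have cn0 : c != 0 by rewrite gt_eqF.
have ce : `|0 - c| < e by rewrite sub0r normrN gtr0_norm //; move: ch; rewrite /h; lra.
have := eP c ce cn0.
rewrite /= D0 subr0 [c *: w + x]addrC [_ *: _]mulrC => /ltr_normlP[_ q].
have q' : 0 < 'D_w f (x + c *: w) / c.
  by rewrite ltrBlDr ltrDl in q.
by move: q'; rewrite pmulr_lgt0 // invr_gt0.
Qed.

Lemma is_derive_translate (R : realType) (V : normedModType R) (f : V -> R)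
  (b x v : V) : derivable f (x + b) v ->
  is_derive x v (fun y => f (y + b)) ('D_v f (x + b)).
Proof.
have E : (fun k => k^-1 *: (((fun y => f (y + b)) \o shift x) (k *: v) - f (x + b)))
  = (fun k => k^-1 *: ((f \o shift (x + b)) (k *: v) - f (x + b))).
  by apply/funext => k /=; rewrite addrA.
by move=> df; apply: DeriveDef; rewrite /derivable /derive E.
Qed.

Lemma derive_dirC (R : realType) (V : normedModType R) (f : V -> R) (x v w : V) :
  (forall y, derivable f y v) -> (forall y, derivable f y w) ->
  (forall y, derivable ('D_v f) y w) -> (forall y, derivable ('D_w f) y v) ->
  {for x, continuous ('D_w ('D_v f))} -> {for x, continuous ('D_v ('D_w f))} ->
  'D_v ('D_w f) x = 'D_w ('D_v f) x.
Proof.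
have tri (a b z : R) : `|z - b| < `|a - b| / 2 -> `|z - a| < `|a - b| / 2 -> False.
  by move=> zb za; have := ler_distD z a b; rewrite (distrC a z); lra.
move=> dv dw dvw dwv cvw cwv; apply/eqP; rewrite -subr_eq0; apply/eqP.
set A := 'D_v ('D_w f) x; set B := 'D_w ('D_v f) x.
apply/normr0_eq0/eqP; rewrite eq_le normr_ge0 andbT leNgt; apply/negP => e0.
have e20 : 0 < `|A - B| / 2 by lra.
have [d1 d10 H1] := continuous_ball _ _ _ _ _ cvw e20.
have [d2 d20 H2] := continuous_ball _ _ _ _ _ cwv e20.
(* The second difference of f over a small parallelogram is, by the mean value
   theorem used twice, h^2 times a value of either mixed derivative near x. *)
have main (g : V -> R) (a b : V) (h : R) : (forall y, derivable g y a) ->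
    (forall y, derivable ('D_a g) y b) -> exists c c' : R,
    [/\ `|c| <= `|h|, `|c'| <= `|h| &
    g (x + h *: a + h *: b) - g (x + h *: a) - (g (x + h *: b) - g x) =
    h * h * 'D_b ('D_a g) (x + c *: a + c' *: b)].
  move=> da dab.
  pose gb : V -> R := fun y => g (y + h *: b).
  have sb y : is_derive y a gb ('D_a g (y + h *: b)).
    exact/is_derive_translate/da.
  have db' y : is_derive y a (gb - g) ('D_a g (y + h *: b) - 'D_a g y).
    exact: (@is_deriveB _ _ _ gb g y a _ _ (sb y) (derivableP (da y))).
  have [c ch E] := @mvt_line _ _ (gb - g) x a h (fun y => @ex_derive _ _ _ _ _ _ _ (db' y)).
  have [c' ch' E'] := @mvt_line _ _ ('D_a g) (x + c *: a) b h dab.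
  exists c, c'; split => //.
  rewrite -mulrA -E' -(@derive_val _ _ _ _ _ _ _ (db' _)) -E.
  by [].
have k0 : 0 < `|v| + `|w| + 1 by rewrite ltr_wpDl // addr_ge0.
pose h := Num.min d1 d2 / (`|v| + `|w| + 1) / 2.
have m0 : 0 < Num.min d1 d2 by rewrite lt_min d10.
have h0 : 0 < h by rewrite /h !divr_gt0.
have small (a b : V) (c c' : R) : `|a| + `|b| = `|v| + `|w| ->
    `|c| <= `|h| -> `|c'| <= `|h| -> `|x + c *: a + c' *: b - x| < Num.min d1 d2.
  move=> ab ch ch'; rewrite addrC !addrA addNr add0r.
  apply: le_lt_trans (_ : h * (`|v| + `|w| + 1) < _); last first.
    have := divr_gt0 m0 k0; rewrite -ltr_pdivlMr // /h; lra.
  apply: le_trans (ler_normD _ _) _; rewrite !normrZ -ab.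
  rewrite (gtr0_norm h0) in ch ch'.
  have := ler_wpM2r (normr_ge0 a) ch; have := ler_wpM2r (normr_ge0 b) ch'; lra.
have [c1 [c1' [b1 b1' E1]]] := main f v w h dv dvw.
have [c2 [c2' [b2 b2' E2]]] := main f w v h dw dwv.
have := E1; have -> : f (x + h *: v + h *: w) - f (x + h *: v) - (f (x + h *: w) - f x)
  = f (x + h *: w + h *: v) - f (x + h *: w) - (f (x + h *: v) - f x).
  by rewrite [x + h *: v + h *: w]addrAC; ring.
rewrite E2; have hh0 : h * h != 0 by rewrite mulf_neq0 // gt_eqF.
move/(mulfI hh0) => E.
have s1 := small v w _ _ erefl b1 b1'.
have s2 := small w v _ _ (addrC _ _) b2 b2'.
have {}s1 := H1 _ (lt_le_trans s1 (_ : _ <= d1)).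
have {}s2 := H2 _ (lt_le_trans s2 (_ : _ <= d2)).
move: s1; rewrite ge_min lexx => /(_ isT).
move: s2; rewrite ge_min lexx orbT => /(_ isT).
rewrite E => p q.
apply: (tri A B _ q p).
Qed.

Lemma is_derive_of_line (R : realType) (V : normedModType R) (f : V -> R)
  (x v : V) (d : R) : is_derive (0 : R) (1 : R) (fun s : R => f (x + s *: v)) d ->
  is_derive x v f d.
Proof.
have E : (fun h : R => h^-1 *: (((fun s : R => f (x + s *: v)) \o shift 0) (h *: 1)
    - f (x + 0 *: v)))
  = (fun h => h^-1 *: ((f \o shift x) (h *: v) - f x)).
  by apply/funext => h /=; rewrite scale0r !addr0 [h%:A]mulr1 [_ + x]addrC.
case=> D1 D2; apply: DeriveDef; first by move: D1; rewrite /derivable E.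
by move: D2; rewrite /derive E.
Qed.

Lemma is_derive_sqrt (R : realType) (V : normedModType R) (f : V -> R)
  (x v : V) (d : R) : 0 < f x -> is_derive x v f d ->
  is_derive x v (fun y => Num.sqrt (f y)) (d / (2 * Num.sqrt (f x))).
Proof.
move=> f0 df; apply: is_derive_of_line.
have dv' : derivable f (x + 0 *: v) v by rewrite scale0r addr0; exact: ex_derive.
have := is_derive_line _ _ f x v 0 dv'.
rewrite scale0r addr0 (@derive_val _ _ _ _ _ _ _ df) => H.
have := @is_derive1_comp R Num.sqrt (fun s : R => f (x + s *: v)) 0
  ((2 * Num.sqrt (f x))^-1) d.
rewrite scale0r addr0 => /(_ _ H) C; rewrite mulrC.
apply: C; exact: is_derive1_sqrt.
Qed.

(** * Smooth functions *)

Section Smooth.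
Context {R : realType} {n : nat}.
Implicit Types (f g : 'rV[R]_n -> R) (v w x : 'rV[R]_n).

Lemma CkW k f : Ck k.+1 f -> Ck k f.
Proof.
elim: k f => [|k IH] f; first by case.
move=> [cf H]; split => // i; have [d D] := H i.
by split => //; apply: IH.
Qed.

Lemma Ck_cst k (c : R) : Ck k (cst c : 'rV[R]_n -> R).
Proof.
elim: k c => [|k IH] c; first by move=> x; exact: cst_continuous.
split; first by move=> x; exact: cst_continuous.
move=> i; split; first by move=> x; exact: derivable_cst.
suff -> : pderiv i (cst c : 'rV[R]_n -> R) = cst 0 by [].
by apply/funext => x; rewrite /pderiv derive_cst.
Qed.

Lemma CkD k f g : Ck k f -> Ck k g -> Ck k (f + g).
Proof.
elim: k f g => [|k IH] f g; first by move=> cf cg x; apply: continuousD; [exact: cf|exact: cg].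
move=> [cf Hf] [cg Hg]; split.
  by move=> x; apply: continuousD; [exact: cf|exact: cg].
move=> i; have [df Df] := Hf i; have [dg Dg] := Hg i; split.
  by move=> x; apply: derivableD.
suff -> : pderiv i (f + g) = pderiv i f + pderiv i g by apply: IH.
by apply/funext => x; rewrite /pderiv deriveD.
Qed.

Lemma CkM k f g : Ck k f -> Ck k g -> Ck k (f * g).
Proof.
elim: k f g => [|k IH] f g; first by move=> cf cg x; apply: continuousM; [exact: cf|exact: cg].
move=> Cf Cg; have [cf Hf] := Cf; have [cg Hg] := Cg; split.
  by move=> x; apply: continuousM; [exact: cf|exact: cg].
move=> i; have [df Df] := Hf i; have [dg Dg] := Hg i; split.
  by move=> x; apply: derivableM.
suff -> : pderiv i (f * g) = f * pderiv i g + g * pderiv i f.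
  by apply: CkD; apply: IH => //; exact: CkW.
by apply/funext => x; rewrite /pderiv deriveM.
Qed.

Lemma is_derive_coord (i : 'I_n) x v :
  is_derive x v (fun y : 'rV[R]_n => y 0 i) (v 0 i).
Proof.
have E h : h != 0 -> h^-1 *: (((fun y : 'rV[R]_n => y 0 i) \o shift x) (h *: v) - x 0 i) = v 0 i.
  by move=> h0; rewrite /= !mxE addrK [LHS]mulrA mulVf // mul1r.
have C : h^-1 *: (((fun y : 'rV[R]_n => y 0 i) \o shift x) (h *: v) - x 0 i) @[h --> 0^'] --> v 0 i.
  apply/cvgrPdist_lt => e e0.
  by near=> h; rewrite E ?subrr ?normr0 //; near: h; exact: nbhs_dnbhs_neq.
apply: DeriveDef; last exact: cvg_lim C.
by apply/cvg_ex; exists (v 0 i).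
Unshelve. all: by end_near. Qed.

Lemma Ck_coord k (i : 'I_n) : Ck k (fun x : 'rV[R]_n => x 0 i).
Proof.
have c : continuous (fun x : 'rV[R]_n => x 0 i) by exact: coord_continuous.
case: k => [|k] //; split => // j; split.
  by move=> x; exact: (@ex_derive _ _ _ _ _ _ _ (is_derive_coord i x _)).
suff -> : pderiv j (fun x : 'rV[R]_n => x 0 i) = cst ((delta_mx 0 j : 'rV[R]_n) 0 i).
  exact: Ck_cst.
apply/funext => x.
exact: (@derive_val _ _ _ _ _ _ _ (is_derive_coord i x _)).
Qed.

Lemma smooth_cst (c : R) : smooth (cst c : 'rV[R]_n -> R).
Proof. by move=> k; exact: Ck_cst. Qed.

Lemma smooth_coord (i : 'I_n) : smooth (fun x : 'rV[R]_n => x 0 i).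
Proof. by move=> k; exact: Ck_coord. Qed.

Lemma smoothD f g : smooth f -> smooth g -> smooth (f + g).
Proof. by move=> sf sg k; exact: CkD. Qed.

Lemma smoothM f g : smooth f -> smooth g -> smooth (f * g).
Proof. by move=> sf sg k; exact: CkM. Qed.

Lemma smoothX f k : smooth f -> smooth (f ^+ k).
Proof.
move=> sf; elim: k => [|k IH]; first by rewrite expr0; exact: (smooth_cst 1).
by rewrite exprS; exact: smoothM.
Qed.

Lemma smooth_sum (I : Type) (r : seq I) (F : I -> 'rV[R]_n -> R) :
  (forall i, smooth (F i)) -> smooth (\sum_(i <- r) F i).
Proof.
move=> sF; elim: r => [|i r IH]; first by rewrite big_nil; exact: (smooth_cst 0).
by rewrite big_cons; exact: smoothD.
Qed.

Lemma smooth_continuous f : smooth f -> continuous f.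
Proof. by move=> /(_ 0%N). Qed.

Lemma smooth_pderiv f i : smooth f -> smooth (pderiv i f).
Proof. by move=> sf k; have [_ /(_ i)[]] := sf k.+1. Qed.

(** Continuity of the partial derivatives makes the derivative additive in the
    direction, one coordinate after the other. *)
Lemma smooth_is_derive f x v : smooth f ->
  is_derive x v f (\sum_i v 0 i * pderiv i f x).
Proof.
move=> sf; rewrite [v in is_derive x v](row_sum_delta v).
have d i y : derivable f y (delta_mx 0 i : 'rV[R]_n).
  by have [_ /(_ i)[]] := sf 1%N.
have dZ i (a : R) y : is_derive y (a *: (delta_mx 0 i : 'rV[R]_n)) f (a * pderiv i f y).
  exact: is_derive_dirZ.
elim: (index_enum _) => [|i r IH]; first by rewrite !big_nil; exact: is_derive0.
rewrite !big_cons addrC [X in is_derive _ _ _ X]addrC.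
rewrite -(@derive_val _ _ _ _ _ _ _ IH) -(@derive_val _ _ _ _ _ _ _ (dZ i _ _)).
apply: is_derive_dirD.
- by move=> y; exact: (@ex_derive _ _ _ _ _ _ _ (dZ i _ _)).
- have -> : 'D_(v 0 i *: (delta_mx 0 i : 'rV[R]_n)) f = cst (v 0 i) * pderiv i f.
    by apply/funext => y; exact: (@derive_val _ _ _ _ _ _ _ (dZ i _ _)).
  apply: smooth_continuous; apply: smoothM; first exact: smooth_cst.
  exact: smooth_pderiv.
- exact: (@ex_derive _ _ _ _ _ _ _ IH).
Qed.

Lemma smooth_derivable f x v : smooth f -> derivable f x v.
Proof. by move=> sf; exact: (@ex_derive _ _ _ _ _ _ _ (smooth_is_derive f x v sf)). Qed.

Lemma derive_pderiv f x v : smooth f -> 'D_v f x = \sum_i v 0 i * pderiv i f x.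
Proof. by move=> sf; exact: (@derive_val _ _ _ _ _ _ _ (smooth_is_derive f x v sf)). Qed.

Lemma smooth_derive f v : smooth f -> smooth ('D_v f).
Proof.
move=> sf; have -> : 'D_v f = \sum_i (cst (v 0 i) * pderiv i f).
  by apply/funext => x; rewrite derive_pderiv // fct_sumE.
apply: smooth_sum => i; apply: smoothM; first exact: smooth_cst.
exact: smooth_pderiv.
Qed.

Lemma smooth_deriveC f v w : smooth f -> 'D_v ('D_w f) = 'D_w ('D_v f).
Proof.
move=> sf; apply/funext => x; have sv := smooth_derive f v sf.
have sw := smooth_derive f w sf.
apply: derive_dirC; try by move=> y; exact: smooth_derivable.
  by apply: smooth_continuous; exact: smooth_derive.
by apply: smooth_continuous; exact: smooth_derive.
Qed.

(** The final [x] in a name marks the form for the value at a point: a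
    derivative applied to a point is no longer an instance of the equality of
    functions. *)
Lemma smooth_deriveCx f v w x : smooth f ->
  'D_v ('D_w f) x = 'D_w ('D_v f) x.
Proof. by move=> sf; move/(congr1 (fun h => h x)): (smooth_deriveC f v w sf). Qed.

Lemma smooth_deriveD f g v : smooth f -> smooth g ->
  'D_v (f + g) = 'D_v f + 'D_v g.
Proof.
by move=> sf sg; apply/funext => x; apply: deriveD; exact: smooth_derivable.
Qed.

Lemma smooth_deriveM f g v : smooth f -> smooth g ->
  'D_v (f * g) = f * 'D_v g + g * 'D_v f.
Proof.
by move=> sf sg; apply/funext => x; apply: deriveM; exact: smooth_derivable.
Qed.

Lemma derive_cst_fun (c : R) v : 'D_v (cst c : 'rV[R]_n -> R) = 0.
Proof. by apply/funext => x; exact: derive_cst. Qed.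

Lemma derive_coord (i : 'I_n) v :
  'D_v (fun x : 'rV[R]_n => x 0 i) = cst (v 0 i).
Proof.
by apply/funext => x; exact: (@derive_val _ _ _ _ _ _ _ (is_derive_coord i x v)).
Qed.

Lemma smooth_deriveDx f g v x : smooth f -> smooth g ->
  'D_v (f + g) x = 'D_v f x + 'D_v g x.
Proof. by move=> sf sg; apply: deriveD; exact: smooth_derivable. Qed.

Lemma smooth_deriveMx f g v x : smooth f -> smooth g ->
  'D_v (f * g) x = f x * 'D_v g x + g x * 'D_v f x.
Proof. by move=> sf sg; apply: deriveM; exact: smooth_derivable. Qed.

Lemma smooth_deriveZx f (c : R) v x : smooth f ->
  'D_v (cst c * f) x = c * 'D_v f x.
Proof.
move=> sf; rewrite smooth_deriveMx //; last exact: smooth_cst.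
by rewrite derive_cst mulr0 addr0.
Qed.

Lemma smooth_deriveXx f k v x : smooth f ->
  'D_v (f ^+ k.+1) x = k.+1%:R * f x ^+ k * 'D_v f x.
Proof.
move=> sf; elim: k => [|k IH]; first by rewrite expr1 expr0 !mul1r.
rewrite exprS smooth_deriveMx //; last exact: smoothX.
by rewrite IH !fctE /= [f x ^+ k.+1]exprS -[k.+2]addn1 natrD; ring.
Qed.

Lemma smooth_derive_sumx (I : Type) (r : seq I) (F : I -> 'rV[R]_n -> R) v x :
  (forall i, smooth (F i)) ->
  'D_v (\sum_(i <- r) F i) x = \sum_(i <- r) 'D_v (F i) x.
Proof.
move=> sF; elim: r => [|i r IH]; first by rewrite !big_nil; exact: (derive_cst 0).
by rewrite !big_cons smooth_deriveDx ?IH //; exact: smooth_sum.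
Qed.

Lemma smooth_line_max f x w (d : R) : smooth f -> 0 < d ->
  (forall t, `|t| < d -> f (x + t *: w) <= f x) ->
  'D_w f x = 0 /\ 'D_w ('D_w f) x <= 0.
Proof.
move=> sf; apply: local_max_dir => [y|]; first exact: smooth_derivable.
by apply: smooth_derivable; exact: smooth_derive.
Qed.

Lemma smooth_derive0_cst f : smooth f -> (forall x v, 'D_v f x = 0) ->
  forall x, f x = f 0.
Proof.
move=> sf D0 x.
have [c _] := @mvt_line _ _ f 0 x 1 (fun y => smooth_derivable f y x sf).
by rewrite D0 mulr0 add0r scale1r => /eqP; rewrite subr_eq0 => /eqP.
Qed.

End Smooth.

(* Two directional derivatives are to be compared through their arguments: the
   limits behind them must not be unfolded. *)
Opaque derive smooth.

(** * Operators built from a frame *)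

Lemma sum_CauchySchwarz (R : realFieldType) (I : finType) (a b : I -> R) :
  (\sum_i a i * b i) ^+ 2 <= (\sum_i a i ^+ 2) * (\sum_i b i ^+ 2).
Proof.
set A := \sum_i a i ^+ 2; set B := \sum_i b i ^+ 2; set S := \sum_i _.
have A0 : 0 <= A by apply: sumr_ge0 => i _; exact: sqr_ge0.
have H : 0 <= A * (A * B - S ^+ 2).
  have -> : A * (A * B - S ^+ 2) = \sum_i (A * b i - S * a i) ^+ 2.
    rewrite [RHS](eq_bigr (fun i => A ^+ 2 * b i ^+ 2
      - 2 * A * S * (a i * b i) + S ^+ 2 * a i ^+ 2)); last by move=> i _; ring.
    rewrite !big_split /= sumrN -!mulr_sumr -/A -/B -/S; ring.
  by apply: sumr_ge0 => i _; exact: sqr_ge0.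
have [Apos|] := ltP 0 A; first by rewrite -subr_ge0 -(pmulr_rge0 _ Apos).
move=> A0'; have /eqP Az : A == 0 by rewrite eq_le A0' A0.
have az i : a i = 0.
  have := Az; rewrite /A => /eqP.
  rewrite psumr_eq0 => [|j _]; last exact: sqr_ge0.
  by move/allP => /(_ i (mem_index_enum _)); rewrite implyTb sqrf_eq0 => /eqP.
by rewrite /S big1 ?expr0n /= ?Az ?mul0r // => i _; rewrite az mul0r.
Qed.

Section Frame.
Context {R : realType} {n : nat}.
Implicit Types (f g : 'rV[R]_n -> R) (x v : 'rV[R]_n) (s : 'I_n -> 'rV[R]_n).

(** A frame [s] stands for the positive semidefinite matrix [a] that is the sum
    of the [s_l s_l^T]: [frame_grad] is the form [a(Df, Dg)] and [frame_lap] is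
    [a_ij D_ij f]. *)
Definition frame_grad s f g x : R := \sum_l 'D_(s l) f x * 'D_(s l) g x.

Definition frame_lap s f x : R := \sum_l 'D_(s l) ('D_(s l) f) x.

(** For the frame of the graph below, this is the operator of the translator
    equation.  A frame is a family of constant vectors, so derivatives do not
    see that the frame of the graph changes from point to point. *)
Definition drift_lap s (T : 'rV[R]_n) f x : R := frame_lap s f x + 'D_T f x.

Lemma frame_gradC s f g x : frame_grad s f g x = frame_grad s g f x.
Proof. by apply: eq_bigr => l _; rewrite mulrC. Qed.

Lemma frame_grad_ge0 s f x : 0 <= frame_grad s f f x.
Proof. by apply: sumr_ge0 => l _; rewrite -expr2 sqr_ge0. Qed.

Lemma frame_grad_cstr s f (c : R) x : frame_grad s f (cst c) x = 0.
Proof. by rewrite /frame_grad big1 // => l _; rewrite derive_cst mulr0. Qed.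

Lemma frame_gradDr s f g h x : smooth g -> smooth h ->
  frame_grad s f (g + h) x = frame_grad s f g x + frame_grad s f h x.
Proof.
move=> sg sh; rewrite /frame_grad -big_split /=; apply: eq_bigr => l _.
by rewrite smooth_deriveDx // -mulrDr.
Qed.

Lemma frame_gradMr s f g h x : smooth g -> smooth h ->
  frame_grad s f (g * h) x = g x * frame_grad s f h x + h x * frame_grad s f g x.
Proof.
move=> sg sh; rewrite /frame_grad !mulr_sumr -big_split /=; apply: eq_bigr => l _.
rewrite smooth_deriveMx //; ring.
Qed.

Lemma frame_grad_sumr s f (I : Type) (r : seq I) (F : I -> 'rV[R]_n -> R) x :
  (forall i, smooth (F i)) ->
  frame_grad s f (\sum_(i <- r) F i) x = \sum_(i <- r) frame_grad s f (F i) x.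
Proof.
move=> sF; elim: r => [|i r IH].
  by rewrite !big_nil; exact: (frame_grad_cstr s f 0 x).
by rewrite !big_cons frame_gradDr ?IH //; exact: smooth_sum.
Qed.

Lemma frame_lap_cst s (c : R) x : frame_lap s (cst c) x = 0.
Proof.
rewrite /frame_lap big1 // => l _; rewrite derive_cst_fun.
exact: (derive_cst (0 : R)).
Qed.

Lemma frame_lapD s f g x : smooth f -> smooth g ->
  frame_lap s (f + g) x = frame_lap s f x + frame_lap s g x.
Proof.
move=> sf sg; rewrite /frame_lap -big_split /=; apply: eq_bigr => l _.
by rewrite smooth_deriveD // smooth_deriveDx //; exact: smooth_derive.
Qed.

Lemma frame_lapM s f g x : smooth f -> smooth g ->
  frame_lap s (f * g) x = f x * frame_lap s g x + g x * frame_lap s f x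
    + 2 * frame_grad s f g x.
Proof.
have H (a b a1 b1 a2 b2 : R) : a * b2 + b1 * a1 + (b * a2 + a1 * b1) =
  a * b2 + b * a2 + 2 * (a1 * b1) by ring.
move=> sf sg; rewrite /frame_lap /frame_grad !mulr_sumr -!big_split /=.
apply: eq_bigr => l _; have sdf := smooth_derive f (s l) sf.
have sdg := smooth_derive g (s l) sg.
rewrite smooth_deriveM // smooth_deriveDx; [|exact: smoothM..].
rewrite !smooth_deriveMx //; exact: H.
Qed.

Lemma drift_lap_cst s T (c : R) x : drift_lap s T (cst c) x = 0.
Proof. by rewrite /drift_lap frame_lap_cst derive_cst addr0. Qed.

Lemma drift_lapD s T f g x : smooth f -> smooth g ->
  drift_lap s T (f + g) x = drift_lap s T f x + drift_lap s T g x.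
Proof.
by move=> sf sg; rewrite /drift_lap frame_lapD // smooth_deriveDx // addrACA.
Qed.

Lemma drift_lapM s T f g x : smooth f -> smooth g ->
  drift_lap s T (f * g) x = f x * drift_lap s T g x + g x * drift_lap s T f x
    + 2 * frame_grad s f g x.
Proof.
have H (a b p q t p' q' : R) : a * p + b * q + 2 * t + (a * p' + b * q') =
  a * (p + p') + b * (q + q') + 2 * t by ring.
by move=> sf sg; rewrite /drift_lap frame_lapM // smooth_deriveMx //; exact: H.
Qed.

Lemma drift_lapZ s T (c : R) g x : smooth g ->
  drift_lap s T (cst c * g) x = c * drift_lap s T g x.
Proof.
move=> sg; rewrite drift_lapM //; last exact: smooth_cst.
by rewrite drift_lap_cst frame_gradC frame_grad_cstr !mulr0 !addr0.
Qed.

Lemma drift_lap_sum s T (I : Type) (r : seq I) (F : I -> 'rV[R]_n -> R) x :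
  (forall i, smooth (F i)) ->
  drift_lap s T (\sum_(i <- r) F i) x = \sum_(i <- r) drift_lap s T (F i) x.
Proof.
move=> sF; elim: r => [|i r IH].
  by rewrite !big_nil; exact: (drift_lap_cst s T 0 x).
by rewrite !big_cons drift_lapD ?IH //; exact: smooth_sum.
Qed.

Lemma drift_lapX s T f k x : smooth f ->
  drift_lap s T (f ^+ k.+2) x = k.+2%:R * f x ^+ k.+1 * drift_lap s T f x
    + k.+2%:R * k.+1%:R * f x ^+ k * frame_grad s f f x.
Proof.
move=> sf; have G j : frame_grad s f (f ^+ j.+1) x = j.+1%:R * f x ^+ j * frame_grad s f f x.
  rewrite /frame_grad mulr_sumr; apply: eq_bigr => l _.
  rewrite smooth_deriveXx //; ring.
elim: k => [|k IH].
  rewrite expr2 drift_lapM // expr1 expr0; ring.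
rewrite exprS drift_lapM ?IH ?G //; last exact: smoothX.
rewrite !fctE /= !exprS -[k.+3]addn1 -[k.+2]addn1 -[k.+1]addn1 !natrD; ring.
Qed.

End Frame.

(** * The equation of a graphical translator *)

Section Translator.
Context {R : realType} {n : nat}.
Implicit Types (f g : 'rV[R]_n -> R) (x v w T : 'rV[R]_n).

Lemma derive_dirDZ f x v w (a : R) : smooth f ->
  'D_(v + a *: w) f x = 'D_v f x + a * 'D_w f x.
Proof.
move=> sf; rewrite !derive_pderiv // mulr_sumr -big_split /=.
by apply: eq_bigr => i _; rewrite !mxE; ring.
Qed.

Lemma pderiv_deriveC f i v : smooth f -> pderiv i ('D_v f) = 'D_v (pderiv i f).
Proof. exact: smooth_deriveC. Qed.

Lemma pderiv_deriveCx f i v x : smooth f ->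
  pderiv i ('D_v f) x = 'D_v (pderiv i f) x.
Proof. exact: smooth_deriveCx. Qed.

Variable u : 'rV[R]_n -> R.
Hypothesis su : smooth u.

(** The square of the area density, the polynomial in the derivatives of [u] to
    which all estimates refer. *)
Definition tilt2 : 'rV[R]_n -> R := cst 1 + \sum_k pderiv k u ^+ 2.

Let smooth_pu k : smooth (pderiv k u). Proof. exact: smooth_pderiv. Qed.

Lemma smooth_tilt2 : smooth tilt2.
Proof.
apply: smoothD; first exact: smooth_cst.
by apply: smooth_sum => k; apply: smoothX.
Qed.

Lemma tilt2E x : tilt2 x = 1 + \sum_k pderiv k u x ^+ 2.
Proof. by rewrite /tilt2 fctE fct_sumE. Qed.

Lemma tilt2_ge1 x : 1 <= tilt2 x.
Proof. by rewrite tilt2E lerDl sumr_ge0 // => i _; exact: sqr_ge0. Qed.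

Lemma tilt2_gt0 x : 0 < tilt2 x.
Proof. exact: lt_le_trans (tilt2_ge1 x). Qed.

Lemma grad_coord x i : grad u x 0 i = pderiv i u x.
Proof. by rewrite mxE. Qed.

Lemma area_densityE x : area_density u x = Num.sqrt (tilt2 x).
Proof.
rewrite /area_density /enorm sqr_sqrtr ?tilt2E; last first.
  by apply: sumr_ge0 => i _; rewrite -expr2 sqr_ge0.
by congr (Num.sqrt (1 + _)); apply: eq_bigr => i _; rewrite grad_coord expr2.
Qed.

Lemma area_density_sqr x : area_density u x ^+ 2 = tilt2 x.
Proof. by rewrite area_densityE sqr_sqrtr // ltW // tilt2_gt0. Qed.

Lemma area_density_gt0 x : 0 < area_density u x.
Proof. by rewrite area_densityE sqrtr_gt0 tilt2_gt0. Qed.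

Lemma derive_gradE f x : smooth f ->
  'D_(grad u x) f x = \sum_i pderiv i u x * pderiv i f x.
Proof. by move=> sf; rewrite derive_pderiv //; apply: eq_bigr => i _; rewrite grad_coord. Qed.

Lemma derive_grad_self x : 'D_(grad u x) u x = tilt2 x - 1.
Proof.
rewrite derive_gradE // tilt2E addrC addKr.
by apply: eq_bigr => i _; rewrite expr2.
Qed.

Lemma derive_tilt2 v x : 'D_v tilt2 x = 2 * 'D_(grad u x) ('D_v u) x.
Proof.
rewrite smooth_deriveDx; [|exact: smooth_cst|by apply: smooth_sum => k; apply: smoothX].
rewrite derive_cst add0r smooth_derive_sumx => [|k]; last exact: smoothX.
rewrite derive_gradE; last exact: smooth_derive.
rewrite mulr_sumr; apply: eq_bigr => k _.
by rewrite smooth_deriveXx // expr1 pderiv_deriveC // mulrA.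
Qed.

(** With [W] the area density and [p] the gradient, the matrix
    [1 - p p^T / W^2] of the equation is the square of
    [1 - p p^T / (W (W + 1))]; these are the columns of the latter. *)
Definition graph_frame x (l : 'I_n) : 'rV[R]_n :=
  delta_mx 0 l + (- ((area_density u x * (area_density u x + 1))^-1
    * pderiv l u x)) *: grad u x.

Let derive_frame x l f : smooth f ->
  'D_(graph_frame x l) f x = pderiv l f x
  - (area_density u x * (area_density u x + 1))^-1 * pderiv l u x
    * 'D_(grad u x) f x.
Proof. by move=> sf; rewrite /graph_frame derive_dirDZ // mulNr. Qed.

Let frame_coef (W F G : R) : 0 < W ->
  - 2 * (W * (W + 1))^-1 * (F * G)
  + ((W * (W + 1))^-1) ^+ 2 * (W ^+ 2 - 1) * (F * G) = - (F * G / W ^+ 2).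
Proof.
move=> W0; have W1 : W + 1 != 0 by rewrite gt_eqF // addr_gt0.
by field; rewrite W1 gt_eqF.
Qed.

Lemma frame_gradE f g x : smooth f -> smooth g ->
  frame_grad (graph_frame x) f g x =
  (\sum_i pderiv i f x * pderiv i g x)
    - 'D_(grad u x) f x * 'D_(grad u x) g x / tilt2 x.
Proof.
move=> sf sg; rewrite -area_density_sqr -frame_coef ?area_density_gt0 //.
rewrite area_density_sqr -derive_grad_self.
set k := (_ * _)^-1; set F := 'D_(grad u x) f x; set G := 'D_(grad u x) g x.
rewrite /frame_grad (eq_bigr (fun l => pderiv l f x * pderiv l g x
   + (- (k * G) * (pderiv l u x * pderiv l f x)
   + (- (k * F) * (pderiv l u x * pderiv l g x)
   + k ^+ 2 * F * G * (pderiv l u x * pderiv l u x))))); last first.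
  have H (a b c d e F' G' : R) : (a - e * c * F') * (b - e * c * G') =
    a * b + (- (e * G') * (c * a) + (- (e * F') * (c * b) + e ^+ 2 * F' * G' * (c * c))).
    by ring.
  by move=> l _; rewrite !derive_frame //; exact: H.
rewrite !big_split /= -!mulr_sumr -(derive_gradE f x) // -(derive_gradE g x) //
  -(derive_gradE u x) //.
have H (S k' F' G' P : R) : S + (- (k' * G') * F' + (- (k' * F') * G' + k' ^+ 2 * F' * G' * P))
  = S + (- 2 * k' * (F' * G') + k' ^+ 2 * P * (F' * G')) by ring.
exact: H.
Qed.

Lemma frame_lapE f x : smooth f ->
  frame_lap (graph_frame x) f x =
  (\sum_i pderiv i (pderiv i f) x)
    - 'D_(grad u x) ('D_(grad u x) f) x / tilt2 x.
Proof.
move=> sf; rewrite -[X in _ - X / _]mulr1 -area_density_sqr.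
rewrite -frame_coef ?area_density_gt0 // area_density_sqr -derive_grad_self.
set p := grad u x; set k := (_ * _)^-1.
transitivity (\sum_l (pderiv l (pderiv l f) x
   + (- (2 * k) * (pderiv l u x * pderiv l ('D_p f) x)
   + k ^+ 2 * 'D_p ('D_p f) x * (pderiv l u x * pderiv l u x)))).
  apply: eq_bigr => l _; have sD := smooth_derive f (graph_frame x l) sf.
  have sDp := smooth_derive f p sf.
  rewrite (derive_frame x l _ sD) -/k -/p.
  have -> : 'D_p ('D_(graph_frame x l) f) x = 'D_(graph_frame x l) ('D_p f) x.
    exact: smooth_deriveCx.
  have -> : pderiv l ('D_(graph_frame x l) f) x = 'D_(graph_frame x l) (pderiv l f) x.
    exact: smooth_deriveCx.
  rewrite (derive_frame x l _ (smooth_pderiv f l sf)) (derive_frame x l _ sDp) -/k -/p.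
  have -> : 'D_p (pderiv l f) x = pderiv l ('D_p f) x by exact: smooth_deriveCx.
  have H (a b c d e : R) : a - e * c * b - e * c * (b - e * c * d) =
    a + (- (2 * e) * (c * b) + e ^+ 2 * d * (c * c)) by ring.
  exact: H.
rewrite !big_split /= -!mulr_sumr -(derive_gradE ('D_p f) x); last exact: smooth_derive.
rewrite -(derive_gradE u x) //.
have H (S k' D P : R) : S + (- (2 * k') * D + k' ^+ 2 * D * P)
  = S + (- 2 * k' * (D * 1) + k' ^+ 2 * P * (D * 1)) by ring.
exact: H.
Qed.

Variable T : 'rV[R]_n.

(** The equation, multiplied by [2 W^3] to make it polynomial. *)
Definition translator_eq : Prop := forall x,
  2 * tilt2 x * ((\sum_i pderiv i (pderiv i u) x) + 'D_T u x)
  = \sum_i pderiv i u x * pderiv i tilt2 x.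

Lemma mean_curvatureE x : mean_curvature u x =
  (area_density u x)^-1 * ((\sum_i pderiv i (pderiv i u) x)
    - (\sum_i pderiv i u x * pderiv i tilt2 x) / (2 * tilt2 x)).
Proof.
have W0 := area_density_gt0 x.
have dW i : is_derive x (delta_mx 0 i) (area_density u)
    (pderiv i tilt2 x / (2 * area_density u x)).
  have -> : area_density u = fun y => Num.sqrt (tilt2 y).
    by apply/funext => y; rewrite area_densityE.
  apply: is_derive_sqrt; first exact: tilt2_gt0.
  by apply: derivableP; apply: smooth_derivable; exact: smooth_tilt2.
rewrite /mean_curvature (eq_bigr (fun i => (area_density u x)^-1 *
  (pderiv i (pderiv i u) x - (pderiv i u x * pderiv i tilt2 x) / (2 * tilt2 x)))).
  by rewrite -mulr_sumr sumrB -mulr_suml.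
move=> i _; have dW' := @ex_derive _ _ _ _ _ _ _ (dW i).
have -> : (fun y => pderiv i u y / area_density u y) =
  pderiv i u * (fun y => (area_density u y)^-1) by [].
rewrite {1}/pderiv deriveM; last 2 first.
- exact: smooth_derivable.
- by apply: derivableV => //; rewrite gt_eqF.
rewrite deriveV ?gt_eqF // (@derive_val _ _ _ _ _ _ _ (dW i)) -area_density_sqr.
have H (a b c W : R) : 0 < W -> a *: (- W ^- 2 *: (c / (2 * W))) + W^-1 *: b =
   W^-1 * (b - a * c / (2 * W ^+ 2)).
  by move=> W0'; rewrite /GRing.scale /=; field; rewrite gt_eqF.
exact: H.
Qed.

Lemma translator_eqP :
  (forall x, mean_curvature u x
     = (area_density u x)^-1 * - (\sum_i T 0 i * pderiv i u x)) <-> translator_eq.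
Proof.
have E x : (mean_curvature u x
     = (area_density u x)^-1 * - (\sum_i T 0 i * pderiv i u x)) <->
  (2 * tilt2 x * ((\sum_i pderiv i (pderiv i u) x) + 'D_T u x)
  = \sum_i pderiv i u x * pderiv i tilt2 x).
  rewrite mean_curvatureE -derive_pderiv //.
  have Wn0 : (area_density u x)^-1 != 0 by rewrite invr_eq0 gt_eqF // area_density_gt0.
  have w0 := tilt2_gt0 x.
  have H (a b c w : R) : 0 < w -> a - b / (2 * w) = - c <-> 2 * w * (a + c) = b.
    move=> w0'; split=> [E|<-]; last by field; rewrite gt_eqF.
    have -> : a = b / (2 * w) - c by rewrite -E; ring.
    by field; rewrite gt_eqF.
  split=> [/(mulfI Wn0)/H|/H ->] //; exact.
by split=> H x; apply/E.
Qed.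

End Translator.

(** * The linearized equation *)

Section Linearized.
Context {R : realType} {n : nat}.
Implicit Types (f g : 'rV[R]_n -> R) (x v w : 'rV[R]_n).
Variables (u : 'rV[R]_n -> R) (T : 'rV[R]_n).
Hypothesis su : smooth u.
Hypothesis eqT : translator_eq u T.

Let L f x := drift_lap (graph_frame u x) T f x.

Let smooth_pu k : smooth (pderiv k u). Proof. exact: smooth_pderiv. Qed.
Let sw : smooth (tilt2 u). Proof. exact: smooth_tilt2. Qed.

Lemma drift_lap_u x : L u x = 0.
Proof.
rewrite /L /drift_lap (frame_lapE _ su) //; have := eqT x; have w0 := tilt2_gt0 u x.
have -> : \sum_i pderiv i u x * pderiv i (tilt2 u) x
    = 2 * 'D_(grad u x) ('D_(grad u x) u) x.
  by rewrite -(derive_tilt2 _ su) (derive_gradE u _ x sw).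
have H (S t D w : R) : 0 < w -> 2 * w * (S + t) = 2 * D -> S - D / w + t = 0.
  move=> w0' E; have -> : D = w * (S + t) by lra.
  by field; rewrite gt_eqF.
exact: H.
Qed.

Let derive2_pderiv f i v x : smooth f ->
  'D_v (pderiv i (pderiv i f)) x = pderiv i (pderiv i ('D_v f)) x.
Proof.
move=> sf; rewrite (pderiv_deriveC f i v sf).
exact: (smooth_deriveCx _ v (delta_mx 0 i) x (smooth_pderiv f i sf)).
Qed.

Let derive_rhs v x : 'D_v (\sum_i pderiv i u * pderiv i (tilt2 u)) x =
    2 * (\sum_i pderiv i (tilt2 u) x * pderiv i ('D_v u) x)
    + 2 * 'D_(grad u x) ('D_(grad u x) ('D_v u)) x.
Proof.
have sf : smooth ('D_v u) by exact: smooth_derive.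
have sp i : smooth (pderiv i (tilt2 u)) by exact: smooth_pderiv.
have sfp i : smooth (pderiv i ('D_v u)) by exact: smooth_pderiv.
have sgf : smooth ('D_(grad u x) ('D_v u)) by exact: smooth_derive.
have swv : smooth ('D_v (tilt2 u)) by exact: smooth_derive.
have E1 : 'D_v (\sum_i pderiv i u * pderiv i (tilt2 u)) x =
  \sum_i (pderiv i u x * pderiv i ('D_v (tilt2 u)) x
    + pderiv i (tilt2 u) x * pderiv i ('D_v u) x).
  rewrite (smooth_derive_sumx _ _ _ v x (fun i => smoothM _ _ (smooth_pu i) (sp i))).
  apply: eq_bigr => i _; rewrite (smooth_deriveMx _ _ v x (smooth_pu i) (sp i)).
  by rewrite (pderiv_deriveCx (tilt2 u) i v x sw) (pderiv_deriveCx u i v x su).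
have E2 : 'D_v (tilt2 u) = \sum_k cst 2 * (pderiv k u * pderiv k ('D_v u)).
  apply/funext => y; rewrite (derive_tilt2 _ su) (derive_gradE u _ y sf).
  rewrite mulr_sumr fct_sumE; apply: eq_bigr => k _.
  have H c (g h : 'rV[R]_n -> R) z : c * (g z * h z) = (cst c * (g * h)) z by [].
  exact: (H 2 (pderiv k u) (pderiv k ('D_v u)) y).
have sk k : smooth (pderiv k u * pderiv k ('D_v u)).
  exact: (smoothM _ _ (smooth_pu k) (sfp k)).
have sck k : smooth (cst 2 * (pderiv k u * pderiv k ('D_v u))).
  exact: (smoothM _ _ (smooth_cst 2) (sk k)).
have E3 : 'D_(grad u x) ('D_v (tilt2 u)) x =
   \sum_k (pderiv k u x * pderiv k ('D_(grad u x) ('D_v u)) x * 2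
    + pderiv k (tilt2 u) x * pderiv k ('D_v u) x).
  rewrite E2 (smooth_derive_sumx _ _ _ _ x sck).
  apply: eq_bigr => k _.
  rewrite (smooth_deriveZx _ _ _ x (sk k)).
  rewrite (smooth_deriveMx _ _ _ x (smooth_pu k) (sfp k)).
  have D1 : pderiv k (tilt2 u) x = 2 * 'D_(grad u x) (pderiv k u) x.
    exact: derive_tilt2.
  rewrite D1 (pderiv_deriveCx ('D_v u) k (grad u x) x sf).
  have H (a b c d : R) : 2 * (a * b + c * d) = a * b * 2 + 2 * d * c by ring.
  exact: H.
have G1 := derive_gradE u _ x swv.
have G2 := derive_gradE u _ x sgf.
have H (D S A B C : R) : A = B + S -> C = B -> C = D * 2 + S -> A = 2 * S + 2 * D.
  by move=> -> <- ->; ring.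
apply: H (etrans E1 _) G1 (etrans E3 _); first exact: big_split.
rewrite big_split.
congr (_ + _).
by rewrite G2 mulr_suml.
Qed.

(** The equation differentiated along [v]: its coefficients depend on [Du],
    whence the first order term. *)
Lemma drift_lap_derive v x : tilt2 u x * L ('D_v u) x
  = frame_grad (graph_frame u x) (tilt2 u) ('D_v u) x.
Proof.
have sf : smooth ('D_v u) by exact: smooth_derive.
pose Q : 'rV[R]_n -> R := \sum_i pderiv i (pderiv i u) + 'D_T u.
have sS : smooth (\sum_i pderiv i (pderiv i u)).
  by apply: smooth_sum => i; exact: smooth_pderiv.
have sDT : smooth ('D_T u) by exact: smooth_derive.
have sQ : smooth Q by exact: (smoothD _ _ sS sDT).
have EQ : cst 2 * (tilt2 u * Q) = \sum_i pderiv i u * pderiv i (tilt2 u).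
  apply/funext => y; rewrite fct_sumE /= -[RHS]eqT !fctE /Q !fctE fct_sumE.
  by rewrite mulrA.
have := congr1 (fun h => 'D_v h x) EQ.
rewrite derive_rhs (smooth_deriveZx _ _ v x (smoothM _ _ sw sQ)).
rewrite (smooth_deriveMx _ _ v x sw sQ).
have -> : 'D_v Q x = (\sum_i pderiv i (pderiv i ('D_v u)) x) + 'D_T ('D_v u) x.
  rewrite /Q (smooth_deriveDx _ _ v x sS sDT).
  rewrite (smooth_derive_sumx _ _ _ v x (fun i => smooth_pderiv _ i (smooth_pu i))).
  apply: (congr2 (fun a b : R => a + b) _ (smooth_deriveCx u v T x su)).
  by apply: eq_bigr => i _; exact: derive2_pderiv.
rewrite (frame_gradE u su _ _ x sw sf) /L /drift_lap (frame_lapE u su _ x sf).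
rewrite (derive_tilt2 _ su v).
have : 2 * tilt2 u x * Q x = 'D_(grad u x) (tilt2 u) x.
  rewrite (derive_gradE u _ x sw) -eqT; congr (_ * _).
  by rewrite /Q !fctE fct_sumE.
have w0 := tilt2_gt0 u x.
have H (w q G D S t F P : R) : 0 < w -> 2 * w * q = G ->
    2 * (w * (S + t) + q * (2 * F)) = 2 * P + 2 * D ->
    w * (S - D / w + t) = P - G * F / w.
  move=> w0' <- E; have -> : P = w * (S + t) + q * (2 * F) - D by lra.
  by field; rewrite gt_eqF.
exact: H.
Qed.

End Linearized.

(** * The square of the area density and of the distance *)

Section Tilt.
Context {R : realType} {n : nat}.
Implicit Types (f g : 'rV[R]_n -> R) (x v w : 'rV[R]_n).
Variables (u : 'rV[R]_n -> R) (T : 'rV[R]_n).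
Hypothesis su : smooth u.
Hypothesis eqT : translator_eq u T.

Let L f x := drift_lap (graph_frame u x) T f x.
Let G f g x := frame_grad (graph_frame u x) f g x.

Let smooth_pu k : smooth (pderiv k u). Proof. exact: smooth_pderiv. Qed.
Let smooth_pu2 k : smooth (pderiv k u ^+ 2). Proof. exact: (smoothX _ 2 (smooth_pu k)). Qed.
Let sw : smooth (tilt2 u). Proof. exact: smooth_tilt2. Qed.
Let sSum : smooth (\sum_k pderiv k u ^+ 2).
Proof. exact: (smooth_sum _ _ _ smooth_pu2). Qed.

(** The squared norm of the Hessian in which one of the two indices is measured
    in the metric of the graph. *)
Definition hess2 x : R := \sum_k G (pderiv k u) (pderiv k u) x.

Lemma hess2_ge0 x : 0 <= hess2 x.
Proof. by apply: sumr_ge0 => k _; exact: frame_grad_ge0. Qed.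

(** Squares of solutions of the linearized equation are subsolutions, and the sum
    of their gradient terms is [hess2]. *)
Lemma drift_lap_tilt2 x :
  tilt2 u x * L (tilt2 u) x = 2 * tilt2 u x * hess2 x + G (tilt2 u) (tilt2 u) x.
Proof.
have GE : G (tilt2 u) (tilt2 u) x =
    \sum_k 2 * pderiv k u x * G (tilt2 u) (pderiv k u) x.
  rewrite /G {2}/tilt2 (frame_gradDr _ _ _ _ x (smooth_cst 1) sSum).
  rewrite frame_grad_cstr add0r (frame_grad_sumr _ _ _ _ _ x smooth_pu2).
  apply: eq_bigr => k _; rewrite expr2.
  rewrite (frame_gradMr _ _ _ _ x (smooth_pu k) (smooth_pu k)).
  have H (a b : R) : a * b + a * b = 2 * a * b by ring.
  exact: H.
rewrite GE /L {2}/tilt2 (drift_lapD _ _ _ _ x (smooth_cst 1) sSum).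
rewrite drift_lap_cst add0r (drift_lap_sum _ _ _ _ _ x smooth_pu2).
rewrite /hess2 !mulr_sumr -big_split; apply: eq_bigr => k _.
rewrite (drift_lapX _ _ _ 0 x (smooth_pu k)) expr1 expr0.
have := drift_lap_derive u T su eqT (delta_mx 0 k) x.
have H (w Lu g p q : R) : w * Lu = g ->
    w * (2 * p * Lu + 2 * 1 * 1 * q) = 2 * w * q + 2 * p * g.
  by move=> <-; ring.
exact: H.
Qed.

Lemma grad_tilt2_le x : G (tilt2 u) (tilt2 u) x <= 4 * tilt2 u x * hess2 x.
Proof.
rewrite /hess2 /G /frame_grad exchange_big mulr_sumr.
apply: ler_sum => l _; rewrite (derive_tilt2 u su).
have -> : 'D_(grad u x) ('D_(graph_frame u x l) u) x =
    \sum_k pderiv k u x * 'D_(graph_frame u x l) (pderiv k u) x.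
  rewrite (derive_gradE u _ x (smooth_derive _ _ su)); apply: eq_bigr => k _.
  by rewrite (pderiv_deriveCx u k _ x su).
have := sum_CauchySchwarz _ _ (fun k => pderiv k u x)
  (fun k => 'D_(graph_frame u x l) (pderiv k u) x).
have P : 0 <= \sum_k 'D_(graph_frame u x l) (pderiv k u) x ^+ 2.
  by apply: sumr_ge0 => k _; exact: sqr_ge0.
have W : \sum_k pderiv k u x ^+ 2 <= tilt2 u x by rewrite tilt2E lerDr ler01.
move: P; rewrite [X in 0 <= X -> _](eq_bigr (fun k => 'D_(graph_frame u x l) (pderiv k u) x *
  'D_(graph_frame u x l) (pderiv k u) x)); last by move=> k _; rewrite expr2.
move=> P; rewrite [X in _ <= _ * X -> _](eq_bigr (fun k => 'D_(graph_frame u x l) (pderiv k u) x *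
  'D_(graph_frame u x l) (pderiv k u) x)); last by move=> k _; rewrite expr2.
have H (s t w q : R) : 0 <= q -> t <= w -> s ^+ 2 <= t * q -> 2 * s * (2 * s) <= 4 * w * q.
  move=> q0 tw E; have := ler_wpM2r q0 tw; lra.
exact: H.
Qed.

Lemma frame_grad_le f x : smooth f -> G f f x <= \sum_i pderiv i f x ^+ 2.
Proof.
move=> sf; rewrite /G (frame_gradE u su _ _ x sf sf) lerBlDr.
rewrite (eq_bigr (fun i => pderiv i f x ^+ 2)) => [|i _]; last by rewrite expr2.
rewrite lerDl divr_ge0 //; last by rewrite ltW // tilt2_gt0.
by rewrite -expr2 sqr_ge0.
Qed.

(** Along the graph, the height has a gradient close to [1] where the graph is
    steep; this is why the cut-off of the gradient estimate contains [u]. *)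
Lemma grad_uE x : G u u x = 1 - (tilt2 u x)^-1.
Proof.
rewrite /G (frame_gradE u su _ _ x su su) (derive_grad_self u su).
have -> : \sum_i pderiv i u x * pderiv i u x = tilt2 u x - 1.
  by rewrite tilt2E addrC addKr; apply: eq_bigr => i _; rewrite expr2.
have w0 := tilt2_gt0 u x.
have H (w : R) : 0 < w -> w - 1 - (w - 1) * (w - 1) / w = 1 - w^-1.
  by move=> w0'; field; rewrite gt_eqF.
exact: H.
Qed.

Definition coord_diff x0 (i : 'I_n) : 'rV[R]_n -> R :=
  (fun x => x 0 i) + cst (- x0 0 i).

Lemma smooth_coord_diff x0 i : smooth (coord_diff x0 i).
Proof. exact: (smoothD _ _ (smooth_coord i) (smooth_cst _)). Qed.

Lemma derive_coord_diff x0 i v x : 'D_v (coord_diff x0 i) x = v 0 i.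
Proof.
rewrite (smooth_deriveDx _ _ v x (smooth_coord i) (smooth_cst _)) derive_cst addr0.
exact: (congr1 (fun h => h x) (derive_coord i v)).
Qed.

Lemma drift_lap_coord_diff x0 i x : L (coord_diff x0 i) x = T 0 i.
Proof.
rewrite /L /drift_lap derive_coord_diff /frame_lap big1 ?add0r // => l _.
have -> : 'D_(graph_frame u x l) (coord_diff x0 i) = cst (graph_frame u x l 0 i).
  by apply/funext => y; exact: derive_coord_diff.
exact: derive_cst.
Qed.

Lemma grad_coord_diff_le x0 i x : G (coord_diff x0 i) (coord_diff x0 i) x <= 1.
Proof.
apply: le_trans (frame_grad_le _ x (smooth_coord_diff x0 i)) _.
rewrite (bigD1 i) //= big1 => [|j ji].
  by rewrite /pderiv derive_coord_diff mxE !eqxx expr1n addr0.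
by rewrite /pderiv derive_coord_diff mxE eq_sym (negbTE ji) andbF expr0n.
Qed.

Definition sqdist x0 : 'rV[R]_n -> R := \sum_i coord_diff x0 i ^+ 2.

Let scd2 x0 i : smooth (coord_diff x0 i ^+ 2).
Proof. exact: (smoothX _ 2 (smooth_coord_diff x0 i)). Qed.

Lemma smooth_sqdist x0 : smooth (sqdist x0).
Proof. exact: (smooth_sum _ _ _ (scd2 x0)). Qed.

Lemma sqdistE x0 x : sqdist x0 x = \sum_i (x 0 i - x0 0 i) ^+ 2.
Proof. by rewrite /sqdist fct_sumE. Qed.

Lemma sqdist_ge0 x0 x : 0 <= sqdist x0 x.
Proof. by rewrite sqdistE sumr_ge0 // => i _; exact: sqr_ge0. Qed.

Lemma sqdist_self x0 : sqdist x0 x0 = 0.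
Proof. by rewrite sqdistE big1 // => i _; rewrite subrr expr0n. Qed.

Lemma pderiv_sqdist x0 i x : pderiv i (sqdist x0) x = 2 * (x 0 i - x0 0 i).
Proof.
rewrite /pderiv /sqdist (smooth_derive_sumx _ _ _ _ x (scd2 x0)).
rewrite (bigD1 i) //= big1 => [|j ji].
  rewrite (smooth_deriveXx _ 1 _ x (smooth_coord_diff x0 i)) derive_coord_diff.
  by rewrite mxE !eqxx mulr1 addr0 expr1.
rewrite (smooth_deriveXx _ 1 _ x (smooth_coord_diff x0 j)) derive_coord_diff.
by rewrite mxE (negbTE ji) andbF mulr0.
Qed.

Lemma grad_sqdist_le x0 x : G (sqdist x0) (sqdist x0) x <= 4 * sqdist x0 x.
Proof.
apply: le_trans (frame_grad_le _ x (smooth_sqdist x0)) _.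
rewrite sqdistE mulr_sumr; apply: ler_sum => i _.
rewrite pderiv_sqdist; have H (a : R) : (2 * a) ^+ 2 <= 4 * a ^+ 2.
  by rewrite exprMn -natrX.
exact: H.
Qed.

Lemma drift_lap_sqdist_le x0 x (r : R) : dotv T T = 1 -> 0 <= r ->
  sqdist x0 x <= r ^+ 2 -> L (sqdist x0) x <= 2 * n%:R + 2 * r.
Proof.
move=> T1 r0 xr.
rewrite /L (drift_lap_sum _ _ _ _ _ x (scd2 x0)).
have E : \sum_i drift_lap (graph_frame u x) T (coord_diff x0 i ^+ 2) x =
  2 * (\sum_i (x 0 i - x0 0 i) * T 0 i) + 2 * \sum_i G (coord_diff x0 i) (coord_diff x0 i) x.
  rewrite !mulr_sumr -big_split; apply: eq_bigr => i _.
  rewrite (drift_lapX _ _ _ 0 x (smooth_coord_diff x0 i)) expr1 expr0.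
  have -> : drift_lap (graph_frame u x) T (coord_diff x0 i) x = T 0 i.
    exact: drift_lap_coord_diff.
  have H (a t g : R) : 2 * a * t + 2 * 1 * 1 * g = 2 * (a * t) + 2 * g by ring.
  exact: H.
rewrite E addrC; apply: lerD.
  rewrite ler_pM2l ?ltr0n //.
  apply: le_trans (ler_sum _ (fun i _ => grad_coord_diff_le x0 i x)) _.
  by rewrite sumr_const card_ord.
rewrite ler_pM2l ?ltr0n //; apply: le_trans (ler_norm _) _.
rewrite -(@ler_pXn2r _ 2) ?nnegrE // real_normK ?num_real //.
apply: le_trans (sum_CauchySchwarz _ _ _ _) _.
have -> : \sum_i T 0 i ^+ 2 = 1.
  by rewrite -T1; apply: eq_bigr => i _; rewrite expr2.
by rewrite mulr1 -sqdistE.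
Qed.

(** By the equation [D_T u] is minus [frame_lap u].  This replaces the bound of
    the time derivative of a heat flow by its Hessian. *)
Lemma derive_T_le x : 'D_T u x ^+ 2 <= n%:R * hess2 x.
Proof.
have := drift_lap_u u T su eqT x; rewrite /drift_lap => /eqP.
rewrite addrC addr_eq0 => /eqP ->; rewrite sqrrN.
have -> : frame_lap (graph_frame u x) u x = \sum_(q : 'I_n * 'I_n)
   graph_frame u x q.1 0 q.2 * 'D_(graph_frame u x q.1) (pderiv q.2 u) x.
  rewrite -(pair_bigA _ (fun l k => graph_frame u x l 0 k * 'D_(graph_frame u x l) (pderiv k u) x)).
  apply: eq_bigr => l _.
  rewrite (derive_pderiv _ x (graph_frame u x l) (smooth_derive _ _ su)).
  by apply: eq_bigr => k _; rewrite (pderiv_deriveCx u k _ x su).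
apply: le_trans (sum_CauchySchwarz _ _ _ _) _.
apply: ler_pM; try by apply: sumr_ge0 => q _; exact: sqr_ge0.
  rewrite -(pair_bigA _ (fun l k => graph_frame u x l 0 k ^+ 2)) exchange_big.
  apply: le_trans (_ : \sum_(k < n) (1 : R) <= _); last by rewrite sumr_const card_ord.
  apply: ler_sum => k _; apply: le_trans (grad_coord_diff_le 0 k x).
  rewrite /G /frame_grad; apply: ler_sum => l _.
  by rewrite derive_coord_diff expr2.
rewrite -(pair_bigA _ (fun l k => 'D_(graph_frame u x l) (pderiv k u) x ^+ 2)) exchange_big.
by apply: ler_sum => k _; apply: ler_sum => l _; rewrite expr2.
Qed.

End Tilt.

(** * Maxima over balls *)

Section MaxBall.
Context {R : realType} {n : nat}.
Implicit Types (F : 'rV[R]_n -> R) (x v T : 'rV[R]_n).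

Lemma compact_ball x0 (r : R) : 0 <= r -> compact [set x | sqdist x0 x <= r ^+ 2].
Proof.
move=> r0; apply: bounded_closed_compact.
  exists (`|x0| + r); split; first exact: num_real.
  move=> M /ltW MM x /= xr; apply: le_trans MM.
  rewrite -[x](subrK x0) addrC; apply: le_trans (ler_normD _ _) _.
  rewrite lerD2l {1}/Num.Def.normr /= mx_normrE; apply: bigmax_le => // -[i j] _ /=.
  rewrite !mxE ord1 -(@ler_pXn2r _ 2) ?nnegrE // real_normK ?num_real //.
  apply: le_trans xr; rewrite sqdistE (bigD1 j) //= lerDl.
  by apply: sumr_ge0 => k _; exact: sqr_ge0.
have -> : [set x | sqdist x0 x <= r ^+ 2] = sqdist x0 @^-1` [set y | y <= r ^+ 2] by [].
apply: closed_comp; last exact: closed_le.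
by move=> x _; exact: (smooth_continuous _ (smooth_sqdist x0)).
Qed.

(** The maximum principle in the form used below: at an interior maximum over a
    ball every second order operator without zeroth order term is nonpositive,
    the second order part being a sum of squares of constant directions. *)
Lemma max_in_ball F x0 (r : R) : smooth F -> 0 <= r ->
  exists x, [/\ sqdist x0 x <= r ^+ 2,
    forall y, sqdist x0 y <= r ^+ 2 -> F y <= F x &
    sqdist x0 x < r ^+ 2 -> (forall v, 'D_v F x = 0) /\
      (forall s T, drift_lap s T F x <= 0)].
Proof.
move=> sF r0.
have A0 : [set x | sqdist x0 x <= r ^+ 2] !=set0.
  by exists x0; rewrite /= sqdist_self sqr_ge0.
have cF : {within [set x | sqdist x0 x <= r ^+ 2], continuous F}.
  by apply: continuous_subspaceT; exact: smooth_continuous.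
have [x] := EVT_max_rV A0 (compact_ball x0 r r0) cF.
rewrite inE /= => xr xmax; exists x; split => //.
  by move=> y yr; apply: xmax; rewrite inE.
move=> xr'; have e0 : 0 < r ^+ 2 - sqdist x0 x by rewrite subr_gt0.
have [d d0 dP] := continuous_ball _ _ _ x _ (smooth_continuous _ (smooth_sqdist x0) x) e0.
have line v : 'D_v F x = 0 /\ 'D_v ('D_v F) x <= 0.
  have v0 : 0 < `|v| + 1 by rewrite ltr_wpDl.
  apply: (smooth_line_max F x v (d / (`|v| + 1)) sF); first exact: divr_gt0.
  move=> t td; apply: xmax; rewrite inE /= ltW //.
  have : `|sqdist x0 (x + t *: v) - sqdist x0 x| < r ^+ 2 - sqdist x0 x.
    apply: dP; rewrite addrC addKr normrZ.
    apply: le_lt_trans (_ : `|t| * (`|v| + 1) < d).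
      by rewrite ler_wpM2l // lerDl.
    by rewrite -ltr_pdivlMr.
  move=> /(le_lt_trans (ler_norm _)); by rewrite ltrBlDr subrK.
split=> [v|s T]; first by have [] := line v.
rewrite /drift_lap (proj1 (line T)) addr0.
by apply: sumr_le0 => l _; have [] := line (s l).
Qed.

End MaxBall.

(** The arithmetic of [cutoff_critical] below: [w] is [W^2], and [A], [B], [C] are
    the values of the form [a] on the pairs formed by the gradients of [phi] and
    of [w]. *)
Lemma tilt_bound_scalar (R : realType) (k : nat) (phi w A B C Lphi Lw Q : R) :
  let m : R := k.+2%:R in
  0 < phi -> 1 <= w -> phi * B = - m * w * A -> phi ^+ 2 * C = m ^+ 2 * w ^+ 2 * A ->
  w * Lw = 2 * w * Q + C -> C <= 4 * w * Q ->
  phi ^+ k.+2 * Lw + w * (m * phi ^+ k.+1 * Lphi + m * k.+1%:R * phi ^+ k * A)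
    + 2 * (m * phi ^+ k.+1 * B) <= 0 ->
  (m / 2 - 1) * A <= - phi * Lphi.
Proof.
move=> m p0 w1 EB EC ELw CQ.
have Em : k.+1%:R = m - 1 :> R by rewrite /m -[k.+2]addn1 natrD addrK.
have m0 : 0 < m by rewrite ltr0n.
rewrite Em !exprS; clearbody m; clear Em.
have pk : 0 < phi ^+ k by rewrite exprn_gt0.
have -> : phi * (phi * phi ^+ k) * Lw +
  w * (m * (phi * phi ^+ k) * Lphi + m * (m - 1) * phi ^+ k * A) +
  2 * (m * (phi * phi ^+ k) * B) = phi ^+ k *
   (phi ^+ 2 * Lw + w * (m * phi * Lphi + m * (m - 1) * A) + 2 * m * (phi * B)) by ring.
rewrite (pmulr_rle0 _ pk) EB => I.
have w0 : 0 < w by lra.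
have wm0 : 0 < w * m by exact: mulr_gt0.
have H1 : 3 / 2 * (m ^+ 2 * w * A) <= phi ^+ 2 * Lw.
  rewrite -(ler_pM2l w0).
  have -> : w * (3 / 2 * (m ^+ 2 * w * A)) = 3 / 2 * (phi ^+ 2 * C) by rewrite EC; ring.
  have -> : w * (phi ^+ 2 * Lw) = phi ^+ 2 * (2 * w * Q + C) by rewrite -ELw; ring.
  have p2 : 0 <= phi ^+ 2 by exact: sqr_ge0.
  rewrite mulrCA; apply: ler_wpM2l => //; lra.
rewrite -(ler_pM2l wm0); nra.
Qed.

(** * The gradient estimate *)

(** The scales of the gradient estimate.  Where [w > 2], the cut-off has a squared
    gradient [A] of at least [1 / (128 a r)], by the choice of [c] and because the
    quadratic term contributes only [O(1 / r^2)]; its image [Lphi] is at least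
    [- 4 / r].  Hence [m / 2 - 1 > 512 a] is impossible. *)
Lemma tilt_bound_contra (R : realType) (a r m w A phi Lphi N c q : R) :
  0 < a -> 512 * a <= r -> 1 <= r -> N <= r -> 1024 * a + 2 < m -> 2 < w ->
  0 < phi -> phi <= 1 -> q * r ^+ 2 = 1 -> c ^+ 2 * (16 * a * r) = 1 ->
  c ^+ 2 * (1 - w^-1) / 2 - q ^+ 2 * (4 * r ^+ 2) <= A ->
  - q * (2 * N + 2 * r) <= Lphi ->
  (m / 2 - 1) * A <= - phi * Lphi -> False.
Proof.
move=> a0 ar r1 Nr am w2 p0 p1 Eq Ec HA HL HM.
have r0 : 0 < r by lra.
have q0 : 0 < q.
  have : 0 < q * r ^+ 2 by rewrite Eq.
  by rewrite pmulr_lgt0 // exprn_gt0.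
have w1 : w^-1 < 1 / 2.
  by rewrite mul1r ltf_pV2 ?posrE //; lra.
have c20 : 0 <= c ^+ 2 by exact: sqr_ge0.
have A1 : c ^+ 2 / 4 - 4 * q <= A.
  have E4 : q ^+ 2 * (4 * r ^+ 2) = 4 * q.
    by rewrite (_ : q ^+ 2 * (4 * r ^+ 2) = 4 * q * (q * r ^+ 2)); [rewrite Eq mulr1|ring].
  apply: le_trans HA; rewrite E4 lerD2r.
  have := ler_wpM2l c20 (_ : 1 / 2 <= 1 - w^-1); lra.
have k0 : 0 < 128 * a * r by rewrite !mulr_gt0.
have A2 : 1 <= 128 * a * r * A.
  apply: le_trans (_ : 128 * a * r * (c ^+ 2 / 4 - 4 * q) <= _); last first.
    by rewrite ler_pM2l.
  have -> : 128 * a * r * (c ^+ 2 / 4 - 4 * q) =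
    2 * (c ^+ 2 * (16 * a * r)) - 512 * a * (q * r) by field.
  rewrite Ec; have : 512 * a * (q * r) <= r * (q * r).
    by rewrite ler_wpM2r // mulr_ge0 // ltW.
  have -> : r * (q * r) = q * r ^+ 2 by ring.
  rewrite Eq; lra.
have L1 : - phi * Lphi <= 4 * (q * r).
  have [L0|L0] := leP 0 Lphi.
    have h1 : 0 <= phi * Lphi by rewrite mulr_ge0 // ltW.
    have h2 : 0 <= q * r by rewrite mulr_ge0 // ltW.
    lra.
  have h1 : phi * (- Lphi) <= 1 * (- Lphi) by rewrite ler_wpM2r //; lra.
  have h2 : q * N <= q * r by rewrite ler_pM2l.
  lra.
have : (m / 2 - 1) * 1 <= (m / 2 - 1) * (128 * a * r * A).
  by rewrite ler_wpM2l //; lra.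
have : 128 * a * r * ((m / 2 - 1) * A) <= 128 * a * r * (4 * (q * r)).
  by rewrite ler_pM2l //; apply: le_trans HM L1.
have -> : 128 * a * r * (4 * (q * r)) = 512 * a * (q * r ^+ 2) by ring.
rewrite Eq; have -> : 128 * a * r * ((m / 2 - 1) * A) = (m / 2 - 1) * (128 * a * r * A) by ring.
lra.
Qed.

Section GradientEstimate.
Context {R : realType} {n : nat}.
Implicit Types (f g : 'rV[R]_n -> R) (x v w : 'rV[R]_n).
Variables (u : 'rV[R]_n -> R) (T : 'rV[R]_n).
Hypothesis su : smooth u.
Hypothesis eqT : translator_eq u T.
Hypothesis T1 : dotv T T = 1.

Let sw : smooth (tilt2 u). Proof. exact: smooth_tilt2. Qed.

Variables (x0 : 'rV[R]_n) (b q c : R).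

(** For [q = 1 / r^2] this cuts off to the ball of radius [r] about [x0].  As
    [Lu = 0], the term [c u] costs nothing when [L] is applied, and it
    contributes to the gradient; with [c = 0] the cut-off is purely
    quadratic. *)
Definition cutoff : 'rV[R]_n -> R :=
  cst b + (cst (- q) * sqdist x0 + cst c * u).

Let s1 : smooth (cst (- q) * sqdist x0).
Proof. exact: (smoothM _ _ (smooth_cst _) (smooth_sqdist x0)). Qed.
Let s2 : smooth (cst c * u).
Proof. exact: (smoothM _ _ (smooth_cst _) su). Qed.
Let s12 : smooth (cst (- q) * sqdist x0 + cst c * u).
Proof. exact: (smoothD _ _ s1 s2). Qed.

Lemma smooth_cutoff : smooth cutoff.
Proof. exact: (smoothD _ _ (smooth_cst _) s12). Qed.

Lemma cutoffE x : cutoff x = b + (- q * sqdist x0 x + c * u x).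
Proof. by []. Qed.

Lemma derive_cutoff v x : 'D_v cutoff x = - q * 'D_v (sqdist x0) x + c * 'D_v u x.
Proof.
rewrite (smooth_deriveDx _ _ v x (smooth_cst _) s12) derive_cst add0r.
rewrite (smooth_deriveDx _ _ v x s1 s2) (smooth_deriveZx _ _ v x (smooth_sqdist x0)).
by rewrite (smooth_deriveZx _ _ v x su).
Qed.

Lemma drift_lap_cutoff x : drift_lap (graph_frame u x) T cutoff x =
  - q * drift_lap (graph_frame u x) T (sqdist x0) x.
Proof.
rewrite (drift_lapD _ _ _ _ x (smooth_cst _) s12) drift_lap_cst add0r.
rewrite (drift_lapD _ _ _ _ x s1 s2) (drift_lapZ _ _ _ _ x (smooth_sqdist x0)).
by rewrite (drift_lapZ _ _ _ _ x su) (drift_lap_u u T su eqT) mulr0 addr0.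
Qed.

Lemma grad_cutoff_ge x :
  c ^+ 2 * (1 - (tilt2 u x)^-1) / 2 - q ^+ 2 * (4 * sqdist x0 x)
  <= frame_grad (graph_frame u x) cutoff cutoff x.
Proof.
rewrite -(grad_uE u su x).
apply: le_trans (_ : c ^+ 2 * frame_grad (graph_frame u x) u u x / 2 - q ^+ 2 *
  frame_grad (graph_frame u x) (sqdist x0) (sqdist x0) x <= _).
  rewrite lerD2l lerN2; apply: ler_wpM2l; first exact: sqr_ge0.
  exact: (grad_sqdist_le u su).
rewrite /frame_grad mulr_sumr mulr_suml mulr_sumr -sumrB; apply: ler_sum => l _.
rewrite derive_cutoff.
have H (a d : R) : c ^+ 2 * (d * d) / 2 - q ^+ 2 * (a * a) <=
    (- q * a + c * d) * (- q * a + c * d).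
  rewrite -subr_ge0 (_ : _ - _ = (2 * (- q * a) + c * d) ^+ 2 / 2); last by field.
  by rewrite divr_ge0 // sqr_ge0.
exact: H.
Qed.

Variable k : nat.
Let F : 'rV[R]_n -> R := cutoff ^+ k.+2 * tilt2 u.

Let sp : smooth cutoff := smooth_cutoff.
Let spk : smooth (cutoff ^+ k.+2). Proof. exact: (smoothX _ _ sp). Qed.

Lemma smooth_cutoff_tilt2 : smooth F.
Proof. exact: (smoothM _ _ spk sw). Qed.

(** At a critical point of a power of the cut-off times [W^2], the second
    order terms leave a positive multiple of the squared gradient of the
    cut-off; the multiple grows with the exponent. *)
Lemma cutoff_critical x : 0 < cutoff x -> (forall v, 'D_v F x = 0) ->
  drift_lap (graph_frame u x) T F x <= 0 ->
  (k.+2%:R / 2 - 1) * frame_grad (graph_frame u x) cutoff cutoff x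
  <= - cutoff x * drift_lap (graph_frame u x) T cutoff x.
Proof.
move=> p0 DF LF.
have DE v : cutoff x * 'D_v (tilt2 u) x = - k.+2%:R * tilt2 u x * 'D_v cutoff x.
  have := DF v; rewrite /F (smooth_deriveMx _ _ v x spk sw).
  rewrite (smooth_deriveXx _ _ v x sp).
  have H (p a d m w y : R) : 0 < y -> p * y * a + w * (m * y * d) = 0 ->
      p * a = - m * w * d.
    move=> y0 E; have /eqP : y * (p * a + w * m * d) = 0 by rewrite -E; ring.
    by rewrite mulf_eq0 gt_eqF //= addr_eq0 => /eqP ->; ring.
  have -> : (cutoff ^+ k.+2) x = cutoff x * cutoff x ^+ k.+1.
    by rewrite exprS fctE /= exprfctE.
  by apply: H; rewrite exprn_gt0.
apply: (@tilt_bound_scalar R k (cutoff x) (tilt2 u x)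
  (frame_grad (graph_frame u x) cutoff cutoff x)
  (frame_grad (graph_frame u x) cutoff (tilt2 u) x)
  (frame_grad (graph_frame u x) (tilt2 u) (tilt2 u) x)
  _ (drift_lap (graph_frame u x) T (tilt2 u) x) (hess2 u x)) => //.
- exact: tilt2_ge1.
- rewrite /frame_grad !mulr_sumr; apply: eq_bigr => l _.
  by rewrite mulrCA DE mulrCA.
- rewrite /frame_grad !mulr_sumr; apply: eq_bigr => l _.
  have H (p d m w a : R) : p * d = - m * w * a ->
     p ^+ 2 * (d * d) = m ^+ 2 * w ^+ 2 * (a * a).
    move=> E; have -> : p ^+ 2 * (d * d) = (p * d) * (p * d) by ring.
    by rewrite E; ring.
  exact: H.
- exact: (drift_lap_tilt2 u T su eqT).
- exact: (grad_tilt2_le u su).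
- move: LF; rewrite /F (drift_lapM _ _ _ _ x spk sw) (drift_lapX _ _ _ _ x sp).
  have -> : frame_grad (graph_frame u x) (cutoff ^+ k.+2) (tilt2 u) x =
    k.+2%:R * cutoff x ^+ k.+1 * frame_grad (graph_frame u x) cutoff (tilt2 u) x.
    rewrite /frame_grad mulr_sumr; apply: eq_bigr => l _.
    by rewrite (smooth_deriveXx _ _ _ x sp) mulrA.
  by rewrite exprfctE.
Qed.

End GradientEstimate.

Section Bound.
Context {R : realType} {n : nat}.
Implicit Types (f g : 'rV[R]_n -> R) (x v w : 'rV[R]_n).
Variables (u : 'rV[R]_n -> R) (T : 'rV[R]_n).
Hypothesis su : smooth u.
Hypothesis eqT : translator_eq u T.
Hypothesis T1 : dotv T T = 1.

(** On the ball of radius [r = s^2] the oscillation of [u] is at most of order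
    [sqrt r].  The bound obtained depends on [E] only. *)
Lemma tilt2_bounded (E : R) : 0 < E ->
  (forall x0 x s, 1 <= s -> `|dotv x0 T| <= s ^+ 2 ->
     sqdist x0 x <= (s ^+ 2) ^+ 2 -> `|u x| <= E * s) ->
  exists V, forall x, tilt2 u x <= V.
Proof.
move=> E0 growth.
have a0 : 0 < E ^+ 2 by exact: exprn_gt0.
have [N HN] : exists N : nat, 1024 * E ^+ 2 < N%:R.
  exists (Num.bound (1024 * E ^+ 2)); apply: archi_boundP.
  by rewrite mulr_ge0 // ltW.
(* An odd exponent makes the maximum lie where the cut-off is positive. *)
pose k := N.*2.+1; exists (2 * 2 ^+ k.+2) => x0.
pose s := 1 + 512 * E ^+ 2 + n%:R + `|dotv x0 T|.
have n0 : (0 : R) <= n%:R by [].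
have d0 := normr_ge0 (dotv x0 T).
have s1 : 1 <= s by rewrite /s; lra.
have [sa sn sd] : [/\ 512 * E ^+ 2 <= s, n%:R <= s & `|dotv x0 T| <= s].
  by rewrite /s; split; lra.
clearbody s.
have s0 : 0 < s by lra.
have ss : s <= s ^+ 2 by rewrite expr2 ler_peMl //; exact: ltW.
set r := s ^+ 2 in ss *.
have r0 : 0 < r by exact: lt_le_trans ss.
pose q := (r ^+ 2)^-1; pose c := (4 * E * s)^-1.
have Eq : q * r ^+ 2 = 1 by rewrite /q mulVf // gt_eqF // exprn_gt0.
have c0 : 0 < c by rewrite invr_gt0 !mulr_gt0.
have q0 : 0 < q by rewrite invr_gt0 exprn_gt0.
have ball_u x : sqdist x0 x <= r ^+ 2 -> `|c * u x| <= 1 / 4.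
  move=> xr; have := growth x0 x s s1 (le_trans sd ss) xr.
  rewrite normrM (gtr0_norm c0) => ux.
  apply: le_trans (_ : c * (E * s) <= _); first by rewrite ler_pM2l.
  rewrite /c le_eqVlt; apply/orP; left; apply/eqP.
  by field; rewrite !gt_eqF.
(* As |c u| <= 1/4, the constant 3/4 makes phi at least 1/2 at the centre, at
   most 1 in the ball, and nonpositive on its boundary. *)
pose phi := cutoff u x0 (3 / 4) q c.
have phile1 x : sqdist x0 x <= r ^+ 2 -> phi x <= 1.
  move=> xr; rewrite /phi cutoffE; have /ler_normlP[_ h1] := ball_u x xr.
  have h2 : 0 <= q * sqdist x0 x by rewrite mulr_ge0 ?sqdist_ge0 // ltW.
  rewrite mulNr; lra.
have phi0 : 1 / 2 <= phi x0.
  have /ler_normlP[h1 _] : `|c * u x0| <= 1 / 4.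
    by apply: ball_u; rewrite sqdist_self sqr_ge0.
  rewrite /phi cutoffE sqdist_self mulr0; lra.
have phi_in x : sqdist x0 x <= r ^+ 2 -> 0 < phi x -> sqdist x0 x < r ^+ 2.
  move=> xr p; rewrite lt_neqAle xr andbT; apply: contraTneq p => xE.
  rewrite -leNgt /phi cutoffE xE mulNr Eq.
  have /ler_normlP[_ h1] := ball_u x xr; lra.
have [x [xr xmax xcrit]] := max_in_ball (phi ^+ k.+2 * tilt2 u) x0 r
  (smooth_cutoff_tilt2 u su x0 _ q c k) (ltW r0).
have FE y : (phi ^+ k.+2 * tilt2 u) y = phi y ^+ k.+2 * tilt2 u y.
  by rewrite [LHS]/GRing.mul /= exprfctE.
have Fx0 : phi x0 ^+ k.+2 * tilt2 u x0 <= phi x ^+ k.+2 * tilt2 u x.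
  by rewrite -!FE; apply: xmax; rewrite sqdist_self sqr_ge0.
have p12 : 0 < phi x0 by apply: lt_le_trans phi0; rewrite divr_gt0.
have px : 0 < phi x.
  have : 0 < phi x ^+ k.+2 * tilt2 u x.
    by apply: lt_le_trans Fx0; rewrite mulr_gt0 ?tilt2_gt0 // exprn_gt0.
  rewrite pmulr_lgt0 ?tilt2_gt0 // exprn_odd_gt0 //.
  by rewrite /k /= !negbK odd_double.
have [DF LF] := xcrit (phi_in x xr px).
have w2 : tilt2 u x <= 2.
  rewrite leNgt; apply/negP => w2.
  have HM := cutoff_critical u T su eqT x0 _ q c k x px DF (LF _ T).
  apply: (@tilt_bound_contra R (E ^+ 2) r (k.+2%:R) (tilt2 u x) _ _ _ n%:R c q
    a0 _ _ _ _ w2 px (phile1 x xr) Eq _ _ _ HM).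
  - exact: le_trans ss.
  - exact: le_trans ss.
  - exact: le_trans ss.
  - apply: lt_le_trans (_ : N%:R + 2 <= _); first by rewrite ltrD2r.
    by rewrite -natrD ler_nat addn2 !ltnS leqW // -addnn leq_addr.
  - rewrite /c /r; field; by rewrite !gt_eqF.
  - apply: le_trans (grad_cutoff_ge u su x0 _ q c x).
    rewrite lerD2l lerN2; apply: ler_wpM2l; first exact: sqr_ge0.
    by rewrite ler_pM2l.
  - rewrite (drift_lap_cutoff u T su eqT x0 _ q c x) !mulNr lerN2 ler_pM2l //.
    exact: (drift_lap_sqdist_le u T su x0 x r T1 (ltW r0) xr).
have F2 : phi x ^+ k.+2 * tilt2 u x <= 1 * 2.
  apply: ler_pM => //; first by rewrite exprn_ge0 // ltW.
    by rewrite ltW // tilt2_gt0.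
  by rewrite exprn_ile1 ?phile1 // ltW.
have : (1 / 2) ^+ k.+2 * tilt2 u x0 <= 1 * 2.
  apply: le_trans (le_trans Fx0 F2); apply: ler_wpM2r; first by rewrite ltW // tilt2_gt0.
  by apply: lerXn2r; rewrite ?nnegrE // ltW // divr_gt0.
rewrite !mul1r exprVn mulrC ler_pdivrMr ?exprn_gt0 //.
Qed.

End Bound.

(** * The derivative along the direction of motion vanishes *)

(** The arithmetic of [stationary_critical] below.  [S], [C] and [Wp] are the
    values of the form [a] on the pairs formed by the gradients of the squared
    distance and of [w = W^2].  All errors are bounded by [w (13 + 4 Q) f^2],
    and [f^2] is at most [N Q] in the first summand, at most [V] in the second:
    this is where [A] comes from.  The term [2 A w Q] is twice that. *)
Lemma stationary_scalar (R : realType) (r q N V A w Q f phi Gff Gpf Gpp Mp S C Wp Lp : R) :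
  0 <= N -> N <= r -> 24 <= r -> q * r ^+ 2 = 1 -> 0 <= phi -> phi <= 1 ->
  1 <= w -> w <= V -> 0 <= Q -> f ^+ 2 <= N * Q -> f ^+ 2 <= w ->
  Gpp = q ^+ 2 * S -> S <= 4 * r ^+ 2 -> C <= 4 * w * Q ->
  Lp <= 2 * N + 2 * r -> Mp = - q * (w * Lp - Wp) ->
  0 <= r ^+ 2 * C + 2 * r * Wp + S ->
  0 <= phi ^+ 2 * Gff + 4 * phi * f * Gpf + 4 * f ^+ 2 * Gpp ->
  A = 13 * N + 4 * V ->
  r * (2 * (phi * f) * (f * Mp + 2 * w * Gpf)
     + 2 * w * (phi ^+ 2 * Gff + 2 * phi * f * Gpf + f ^+ 2 * Gpp))
     + A * (2 * w * Q) <= 0 ->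
  f = 0.
Proof.
move=> N0 Nr r24 Eq p0 p1 w1 wV Q0 fQ fw EG HS HC HL EM HW HK EA HF.
have r0 : 0 < r by lra.
have q0 : 0 < q.
  by have : 0 < q * r ^+ 2 by [rewrite Eq]; rewrite pmulr_lgt0 // exprn_gt0.
(* The radius is at least 24 so that the error 24 w f^2 / r is at most w f^2. *)
have rq1 : 24 * (r * q) <= 1.
  have e : r * (r * q) = 1 by rewrite -Eq; ring.
  by rewrite -[leRHS]e ler_pM2r // mulr_gt0.
have f20 : 0 <= f ^+ 2 by exact: sqr_ge0.
have w0 : 0 < w by lra.
have G4 : Gpp <= 4 * q.
  rewrite EG (_ : 4 * q = q ^+ 2 * (4 * r ^+ 2)); last first.
    by rewrite (_ : q ^+ 2 * (4 * r ^+ 2) = 4 * q * (q * r ^+ 2)); [rewrite Eq mulr1|ring].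
  by apply: ler_wpM2l => //; exact: sqr_ge0.
have t1 : 6 * (r * w * f ^+ 2 * Gpp) <= w * f ^+ 2.
  have h : 0 <= r * w * f ^+ 2 by exact: mulr_ge0 (mulr_ge0 (ltW r0) (ltW w0)) f20.
  have := ler_wpM2l h G4.
  have h' : 0 <= w * f ^+ 2 by rewrite mulr_ge0 // ltW.
  have := ler_wpM2l h' rq1.
  rewrite (_ : r * w * f ^+ 2 * (4 * q) = w * f ^+ 2 * (24 * (r * q)) / 6); last by field.
  lra.
(* From the nonnegativity of a on the gradient of r w + |x - x0|^2. *)
have WpB : - (2 * w * Q + 2) <= Wp / r.
  have h : 2 * r * (- (2 * r * (w * Q + 1))) <= 2 * r * Wp.
    have : r ^+ 2 * C <= r ^+ 2 * (4 * w * Q) by apply: ler_wpM2l => //; exact: sqr_ge0.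
    lra.
  rewrite ler_pM2l in h; last by rewrite mulr_gt0.
  rewrite ler_pdivlMr //; lra.
have MpB : - (w * 4 + 2 * w * Q + 2) <= r * Mp.
  have E : r * Mp = - (w * (Lp * (q * r))) + (Wp / r) * (q * r ^+ 2).
    rewrite EM; field; by rewrite gt_eqF.
  rewrite E Eq mulr1.
  have h : Lp * (q * r) <= 4.
    apply: le_trans (_ : (2 * N + 2 * r) * (q * r) <= _).
      by rewrite ler_pM2r // mulr_gt0.
    apply: le_trans (_ : (4 * r) * (q * r) <= _).
      by rewrite ler_pM2r ?mulr_gt0 //; lra.
    rewrite (_ : 4 * r * (q * r) = 4 * (q * r ^+ 2)); last by ring.
    by rewrite Eq mulr1.
  have := ler_wpM2l (ltW w0) h; lra.
have t2 : - (f ^+ 2 * (w * (12 + 4 * Q))) <= 2 * (phi * f ^+ 2 * (r * Mp)).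
  have pf0 : 0 <= phi * f ^+ 2 by rewrite mulr_ge0.
  have h1 := ler_wpM2l pf0 MpB.
  have h3 : 0 <= w * 4 + 2 * w * Q + 2 by have := mulr_ge0 (ltW w0) Q0; lra.
  have h2 : phi * f ^+ 2 * (w * 4 + 2 * w * Q + 2) <= f ^+ 2 * (w * 4 + 2 * w * Q + 2).
    by apply: ler_wpM2r => //; rewrite ler_piMl.
  have h4 : f ^+ 2 * (w * 4 + 2 * w * Q + 2) <= f ^+ 2 * (w * 6 + 2 * w * Q).
    by apply: ler_wpM2l => //; lra.
  lra.
have t3 : 0 <= r * w * (phi ^+ 2 * Gff + 4 * phi * f * Gpf + 4 * f ^+ 2 * Gpp).
  by rewrite mulr_ge0 // mulr_ge0 // ltW.
have t4 : f ^+ 2 * (w * (13 + 4 * Q)) <= w * (Q * A).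
  have h1 : w * f ^+ 2 <= w * (N * Q) by rewrite ler_pM2l.
  have h2 : w * Q * f ^+ 2 <= w * Q * V.
    by apply: ler_wpM2l; [rewrite mulr_ge0 // ltW|exact: le_trans wV].
  rewrite EA; lra.
have t5 : w * (Q * A) <= 0 by lra.
have A0 : 0 < A by rewrite EA; lra.
have Qz : Q <= 0.
  by move: t5; rewrite (pmulr_rle0 _ w0) (pmulr_lle0 _ A0).
have Qe : Q = 0 by apply/le_anti; rewrite Qz Q0.
move: fQ; rewrite Qe mulr0 => f0.
by apply/eqP; rewrite -sqrf_eq0 eq_le f0 f20.
Qed.

Section Stationary.
Context {R : realType} {n : nat}.
Implicit Types (f g : 'rV[R]_n -> R) (x v w : 'rV[R]_n).
Variables (u : 'rV[R]_n -> R) (T : 'rV[R]_n).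
Hypothesis su : smooth u.
Hypothesis eqT : translator_eq u T.
Hypothesis T1 : dotv T T = 1.

Let sw : smooth (tilt2 u). Proof. exact: smooth_tilt2. Qed.

(** The linearization of the equation at [u], multiplied by the square of the
    area density. *)
Definition lin_op f x : R := tilt2 u x * drift_lap (graph_frame u x) T f x
  - frame_grad (graph_frame u x) (tilt2 u) f x.

Lemma lin_opD f g x : smooth f -> smooth g -> lin_op (f + g) x = lin_op f x + lin_op g x.
Proof.
move=> sf sg; rewrite /lin_op (drift_lapD _ _ _ _ x sf sg) (frame_gradDr _ _ _ _ x sf sg).
have H (w a b c d : R) : w * (a + b) - (c + d) = w * a - c + (w * b - d) by ring.
exact: H.
Qed.

Lemma lin_opM f g x : smooth f -> smooth g ->
  lin_op (f * g) x = f x * lin_op g x + g x * lin_op f x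
    + 2 * tilt2 u x * frame_grad (graph_frame u x) f g x.
Proof.
move=> sf sg; rewrite /lin_op (drift_lapM _ _ _ _ x sf sg) (frame_gradMr _ _ _ _ x sf sg).
have H (w a b c d f' g' h : R) : w * (f' * a + g' * b + 2 * h) - (f' * c + g' * d) =
  f' * (w * a - c) + g' * (w * b - d) + 2 * w * h by ring.
exact: H.
Qed.

Lemma lin_op_cst (c : R) x : lin_op (cst c) x = 0.
Proof. by rewrite /lin_op drift_lap_cst frame_grad_cstr mulr0 subr0. Qed.

Lemma lin_opZ (c : R) g x : smooth g -> lin_op (cst c * g) x = c * lin_op g x.
Proof.
move=> sg; rewrite (lin_opM _ _ x (smooth_cst c) sg) lin_op_cst frame_gradC.
by rewrite frame_grad_cstr !mulr0 !addr0.
Qed.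

Lemma lin_op_derive v x : lin_op ('D_v u) x = 0.
Proof. by rewrite /lin_op (drift_lap_derive u T su eqT) subrr. Qed.

Lemma lin_op_tilt2 x : lin_op (tilt2 u) x = 2 * tilt2 u x * hess2 u x.
Proof. by rewrite /lin_op (drift_lap_tilt2 u T su eqT) addrK. Qed.

Lemma lin_op_max f x : (forall v, 'D_v f x = 0) ->
  drift_lap (graph_frame u x) T f x <= 0 -> lin_op f x <= 0.
Proof.
move=> D0 L0; rewrite /lin_op /frame_grad big1 ?subr0; last first.
  by move=> l _; rewrite D0 mulr0.
by rewrite pmulr_rle0 // tilt2_gt0.
Qed.

(** At an interior maximum the last hypothesis holds.  The Hessian term produced
    by [W^2] then dominates all the others, because it also bounds
    [(D_T u)^2]. *)
Lemma stationary_critical (V r q : R) x0 x :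
  n%:R <= r -> 24 <= r -> q * r ^+ 2 = 1 -> sqdist x0 x <= r ^+ 2 ->
  tilt2 u x <= V ->
  lin_op (cst r * (cutoff u x0 1 q 0 * 'D_T u) ^+ 2
    + cst (13 * n%:R + 4 * V) * tilt2 u) x <= 0 ->
  'D_T u x = 0.
Proof.
move=> nr r24 Eq xr wV.
set phi := cutoff u x0 1 q 0.
have sp : smooth phi by exact: smooth_cutoff.
have sf : smooth ('D_T u) by exact: smooth_derive.
have spf : smooth (phi * 'D_T u) by exact: (smoothM _ _ sp sf).
have spf2 : smooth ((phi * 'D_T u) ^+ 2) by exact: (smoothX _ 2 spf).
rewrite (lin_opD _ _ x (smoothM _ _ (smooth_cst r) spf2) (smoothM _ _ (smooth_cst _) sw)).
rewrite (lin_opZ _ _ x spf2) (lin_opZ _ _ x sw) lin_op_tilt2 expr2.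
rewrite (lin_opM _ _ x spf spf) (lin_opM _ _ x sp sf) lin_op_derive mulr0 add0r.
have Gg : frame_grad (graph_frame u x) (phi * 'D_T u) (phi * 'D_T u) x =
  phi x ^+ 2 * frame_grad (graph_frame u x) ('D_T u) ('D_T u) x
  + 2 * phi x * 'D_T u x * frame_grad (graph_frame u x) phi ('D_T u) x
  + 'D_T u x ^+ 2 * frame_grad (graph_frame u x) phi phi x.
  rewrite (frame_gradMr _ _ _ _ x sp sf).
  rewrite (frame_gradC _ (phi * 'D_T u) ('D_T u)) (frame_gradC _ (phi * 'D_T u) phi).
  rewrite !(frame_gradMr _ _ _ _ x sp sf) (frame_gradC _ ('D_T u) phi).
  have H (p f a b c : R) : p * (p * a + f * b) + f * (p * b + f * c) =
    p ^+ 2 * a + 2 * p * f * b + f ^+ 2 * c by ring.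
  exact: H.
rewrite Gg => HF.
have r0 : 0 < r by apply: lt_le_trans r24.
have q0 : 0 < q.
  by have : 0 < q * r ^+ 2 by [rewrite Eq]; rewrite pmulr_lgt0 // exprn_gt0.
have Dphi v : 'D_v phi x = - q * 'D_v (sqdist x0) x.
  by rewrite (derive_cutoff u su) mul0r addr0.
have phi_ge0 : 0 <= phi x.
  rewrite /phi cutoffE mul0r addr0 mulNr subr_ge0 -Eq; apply: ler_wpM2l => //.
  exact: ltW.
have phi_le1 : phi x <= 1.
  rewrite /phi cutoffE mul0r addr0 mulNr gerDl oppr_le0 mulr_ge0 ?sqdist_ge0 //.
  exact: ltW.
apply: (@stationary_scalar R r q n%:R V (13 * n%:R + 4 * V) (tilt2 u x) (hess2 u x)
  ('D_T u x) (phi x)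
  (frame_grad (graph_frame u x) ('D_T u) ('D_T u) x)
  (frame_grad (graph_frame u x) phi ('D_T u) x)
  (frame_grad (graph_frame u x) phi phi x) (lin_op phi x)
  (frame_grad (graph_frame u x) (sqdist x0) (sqdist x0) x)
  (frame_grad (graph_frame u x) (tilt2 u) (tilt2 u) x)
  (frame_grad (graph_frame u x) (tilt2 u) (sqdist x0) x)
  (drift_lap (graph_frame u x) T (sqdist x0) x)) => //.
- exact: tilt2_ge1.
- exact: hess2_ge0.
- exact: (derive_T_le u T su eqT).
- rewrite (derive_pderiv u x T su); apply: le_trans (sum_CauchySchwarz _ _ _ _) _.
  have -> : \sum_i T 0 i ^+ 2 = 1 by rewrite -T1; apply: eq_bigr => i _; rewrite expr2.
  by rewrite mul1r tilt2E lerDr ler01.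
- rewrite /frame_grad mulr_sumr; apply: eq_bigr => l _; rewrite Dphi.
  have H (a : R) : - q * a * (- q * a) = q ^+ 2 * (a * a) by ring.
  exact: H.
- apply: le_trans (grad_sqdist_le u su x0 x) _; by rewrite ler_pM2l.
- exact: (grad_tilt2_le u su).
- exact: (drift_lap_sqdist_le u T su x0 x r T1 (ltW r0) xr).
- rewrite {1}/lin_op (drift_lap_cutoff u T su eqT).
  have -> : frame_grad (graph_frame u x) (tilt2 u) phi x =
      - q * frame_grad (graph_frame u x) (tilt2 u) (sqdist x0) x.
    by rewrite /frame_grad mulr_sumr; apply: eq_bigr => l _; rewrite Dphi mulrCA.
  have H (w a b : R) : w * (- q * a) - - q * b = - q * (w * a - b) by ring.
  exact: H.
- rewrite /frame_grad !mulr_sumr -!big_split; apply: sumr_ge0 => l _ /=.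
  have H (a b : R) : 0 <= r ^+ 2 * (a * a) + 2 * r * (a * b) + b * b.
    by rewrite (_ : _ + _ + _ = (r * a + b) ^+ 2) ?sqr_ge0 //; ring.
  exact: H.
- rewrite /frame_grad !mulr_sumr -!big_split; apply: sumr_ge0 => l _ /=.
  have H (p f a b : R) : 0 <= p ^+ 2 * (a * a) + 4 * p * f * (b * a) + 4 * f ^+ 2 * (b * b).
    by rewrite (_ : _ + _ + _ = (p * a + 2 * f * b) ^+ 2) ?sqr_ge0 //; ring.
  exact: H.
- have H (r' a b c d : R) : r' * (a * b + a * b + c) + d = r' * (2 * a * b + c) + d by ring.
  by move: HF; rewrite H.
Qed.

(** The value at the centre of [r phi^2 f^2 + A W^2] is at most [A V], since [f]
    or [phi] vanishes at the maximum; this bounds [r f^2] as [r] grows. *)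
Lemma translator_stationary (V : R) : (forall x, tilt2 u x <= V) ->
  forall x0, 'D_T u x0 = 0.
Proof.
move=> HV x0; apply/eqP; apply/negPn/negP => f0.
set A := 13 * n%:R + 4 * V.
have f2 : 0 < 'D_T u x0 ^+ 2 by rewrite exprn_even_gt0.
have V1 : 1 <= V by exact: le_trans (tilt2_ge1 u x0) (HV x0).
have n0 : (0 : R) <= n%:R by [].
have A0 : 0 < A by rewrite /A; lra.
have AV0 : 0 < A * V by rewrite mulr_gt0 //; lra.
pose r := n%:R + 24 + A * V / 'D_T u x0 ^+ 2.
have d0 : 0 < A * V / 'D_T u x0 ^+ 2 by rewrite divr_gt0.
have Er : A * V < r * 'D_T u x0 ^+ 2.
  have H (a b c : R) : 0 < a -> 0 < c -> b < (a + b / c) * c.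
    by move=> a0 c0; rewrite mulrDl divfK ?gt_eqF // ltrDr mulr_gt0.
  by apply: H => //; rewrite ltr_wpDl.
have [nr r24] : n%:R <= r /\ 24 <= r.
  by rewrite /r; move: d0; move: (_ / _) => d d0; split; lra.
have r0 : 0 < r by apply: lt_le_trans r24.
clearbody r.
pose q := (r ^+ 2)^-1.
have Eq : q * r ^+ 2 = 1 by rewrite /q mulVf // gt_eqF // exprn_gt0.
pose phi := cutoff u x0 1 q 0.
have sp : smooth phi by exact: smooth_cutoff.
have sf : smooth ('D_T u) by exact: smooth_derive.
pose F : 'rV[R]_n -> R := cst r * (phi * 'D_T u) ^+ 2 + cst A * tilt2 u.
have sF : smooth F.
  apply: smoothD; last exact: (smoothM _ _ (smooth_cst A) sw).
  exact: (smoothM _ _ (smooth_cst r) (smoothX _ 2 (smoothM _ _ sp sf))).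
have FE y : F y = r * (phi y * 'D_T u y) ^+ 2 + A * tilt2 u y by [].
have [x [xr xmax xcrit]] := max_in_ball F x0 r sF (ltW r0).
have Fx : F x <= A * V.
  suff E : phi x * 'D_T u x = 0.
    by rewrite FE E expr0n mulr0 add0r ler_pM2l.
  have [xlt|xge] := ltP (sqdist x0 x) (r ^+ 2).
    have [DF LF] := xcrit xlt.
    by rewrite (stationary_critical V r q x0 x nr r24 Eq xr (HV x)
      (lin_op_max _ _ DF (LF _ T))) mulr0.
  have xE : sqdist x0 x = r ^+ 2 by apply/le_anti; rewrite xr xge.
  by rewrite /phi cutoffE xE mulNr Eq mul0r addr0 subrr mul0r.
have := le_trans (xmax x0 _) Fx; rewrite sqdist_self => /(_ (sqr_ge0 _)).
rewrite FE /phi cutoffE sqdist_self mul0r addr0 mulr0 addr0 mul1r.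
have w0 : 0 <= A * tilt2 u x0 by rewrite mulr_ge0 // ltW // tilt2_gt0.
move=> I; have : r * 'D_T u x0 ^+ 2 <= A * V by apply: le_trans I; rewrite lerDl.
by rewrite leNgt Er.
Qed.

End Stationary.

(** * Bounded translators are flat *)

(** The inequality [LF <= 0] at an interior maximum of
    [F = W^2 + lam u^2 - B q |x - x0|^2], solved for [w = W^2]. *)
Lemma flat_scalar (R : realType) (lam B V r q N w Lw Lu2 Lp : R) :
  0 < lam -> 1 <= w -> w <= V -> 0 < B -> N <= r -> 0 < r -> q * r ^+ 2 = 1 -> 0 <= Lw ->
  Lu2 = 2 * (1 - w^-1) -> Lp <= 2 * N + 2 * r ->
  Lw + (lam * Lu2 + - (B * q) * Lp) <= 0 ->
  w <= 1 + 2 * V * B / (lam * r).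
Proof.
move=> l0 w1 wV B0 Nr r0 Eq HLw HLu HLp I.
have w0 : 0 < w by lra.
have q0 : 0 < q.
  by have : 0 < q * r ^+ 2 by [rewrite Eq]; rewrite pmulr_lgt0 // exprn_gt0.
have Bq0 : 0 < B * q by exact: mulr_gt0.
have h1 : B * q * Lp <= B * q * (4 * r) by rewrite ler_pM2l //; lra.
have h2 : lam * (1 - w^-1) <= 2 * B * (q * r).
  by move: I; rewrite HLu; lra.
have h3 : lam * (w - 1) <= 2 * B * (q * r) * V.
  rewrite (_ : lam * (w - 1) = lam * (1 - w^-1) * w); last by field; rewrite gt_eqF.
  apply: le_trans (_ : 2 * B * (q * r) * w <= _); first by rewrite ler_pM2r.
  by apply: ler_wpM2l => //; rewrite !mulr_ge0 // ltW.
rewrite -lerBlDl ler_pdivlMr ?mulr_gt0 //.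
rewrite (_ : 2 * V * B = 2 * B * V * (q * r ^+ 2)); last by rewrite Eq mulr1; ring.
have := ler_wpM2r (ltW r0) h3; lra.
Qed.

Section Flat.
Context {R : realType} {n : nat}.
Variables (u : 'rV[R]_n -> R) (T : 'rV[R]_n).
Hypothesis su : smooth u.
Hypothesis eqT : translator_eq u T.
Hypothesis T1 : dotv T T = 1.

Let sw : smooth (tilt2 u). Proof. exact: smooth_tilt2. Qed.

(** A nonconstant bounded [u] would make [W^2 + lam u^2] a strict subsolution
    where [W > 1], with a gain of order [lam].  The radius is taken of order
    [1 / lam^2], so that the quadratic term that localizes the maximum costs
    only [O(lam^2)]. *)
Lemma bounded_translator_flat (V C : R) : (forall x, tilt2 u x <= V) ->
  (forall x, `|u x| <= C) -> forall x0, tilt2 u x0 <= 1.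
Proof.
move=> HV HC x0.
have V1 : 1 <= V by exact: le_trans (tilt2_ge1 u x0) (HV x0).
have C0 : 0 <= C by exact: le_trans (HC x0).
have u2 x : u x ^+ 2 <= C ^+ 2.
  by rewrite -[u x ^+ 2]real_normK ?num_real // lerXn2r ?nnegrE.
pose B := V + C ^+ 2.
have C20 : 0 <= C ^+ 2 by exact: sqr_ge0.
have B0 : 0 < B by rewrite /B; lra.
pose K := 2 * V * B + C ^+ 2.
have K0 : 0 <= K by rewrite /K addr_ge0 // !mulr_ge0 //; lra.
have n0 : (0 : R) <= n%:R by [].
have main lam : 0 < lam -> lam <= 1 -> tilt2 u x0 <= 1 + lam * K.
  move=> l0 l1.
  pose r := (n%:R + 1) / lam ^+ 2.
  have l2 : 0 < lam ^+ 2 by exact: exprn_gt0.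
  have r0 : 0 < r by rewrite divr_gt0 //; lra.
  have Nr : n%:R <= r.
    rewrite /r ler_pdivlMr //; have : n%:R * lam ^+ 2 <= n%:R * 1.
      by apply: ler_wpM2l => //; rewrite exprn_ile1 // ltW.
    lra.
  have rl : 1 / (lam * r) <= lam.
    have E : lam * (lam * r) = n%:R + 1 by rewrite /r; field; rewrite gt_eqF.
    rewrite ler_pdivrMr; last exact: mulr_gt0.
    by rewrite E lerDr.
  pose q := (r ^+ 2)^-1.
  have Eq : q * r ^+ 2 = 1 by rewrite /q mulVf // gt_eqF // exprn_gt0.
  have sl : smooth (cst lam * u ^+ 2) by exact: (smoothM _ _ (smooth_cst _) (smoothX _ 2 su)).
  have sb : smooth (cst (- (B * q)) * sqdist x0).
    exact: (smoothM _ _ (smooth_cst _) (smooth_sqdist x0)).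
  have slb := smoothD _ _ sl sb.
  pose F : 'rV[R]_n -> R := tilt2 u + (cst lam * u ^+ 2 + cst (- (B * q)) * sqdist x0).
  have sF : smooth F by exact: (smoothD _ _ sw slb).
  have FE y : F y = tilt2 u y + (lam * u y ^+ 2 + - (B * q) * sqdist x0 y) by [].
  have [x [xr xmax xcrit]] := max_in_ball F x0 r sF (ltW r0).
  have lu2 y : lam * u y ^+ 2 <= lam * C ^+ 2 by rewrite ler_pM2l.
  have lC : lam * C ^+ 2 <= C ^+ 2 by rewrite ler_piMl.
  have lu0 y : 0 <= lam * u y ^+ 2 by rewrite mulr_ge0 ?sqr_ge0 // ltW.
  have Fx0 : tilt2 u x0 + lam * u x0 ^+ 2 <= F x.
    have := xmax x0; rewrite sqdist_self => /(_ (sqr_ge0 _)).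
    by rewrite FE sqdist_self mulr0 addr0.
  have w1 := tilt2_ge1 u x0.
  have xlt : sqdist x0 x < r ^+ 2.
    rewrite lt_neqAle xr andbT; apply/eqP => xE.
    move: Fx0; rewrite FE xE (_ : - (B * q) * r ^+ 2 = - B * (q * r ^+ 2)); last by ring.
    rewrite Eq mulr1 /B.
    have := lu0 x0; have := lu2 x; have := HV x.
    move: (tilt2 u x) (tilt2 u x0) (u x) (u x0) w1 lC C20 => *; lra.
  have [_ /(_ (graph_frame u x) T) LF] := xcrit xlt.
  have wx : tilt2 u x <= 1 + 2 * V * B / (lam * r).
    apply: (@flat_scalar R lam B V r q n%:R _ (drift_lap (graph_frame u x) T (tilt2 u) x)
      (drift_lap (graph_frame u x) T (u ^+ 2) x)
      (drift_lap (graph_frame u x) T (sqdist x0) x)) => //.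
    - exact: tilt2_ge1.
    - rewrite -(pmulr_rge0 _ (tilt2_gt0 u x)) (drift_lap_tilt2 u T su eqT).
      rewrite addr_ge0 ?frame_grad_ge0 // !mulr_ge0 ?hess2_ge0 // ltW //.
      exact: tilt2_gt0.
    - rewrite (drift_lapX _ _ _ 0 x su) (drift_lap_u u T su eqT) expr0.
      rewrite (grad_uE u su x) mulr0 add0r; congr (_ * _); by rewrite !mulr1.
    - exact: (drift_lap_sqdist_le u T su x0 x r T1 (ltW r0) xr).
    - move: LF; rewrite /F (drift_lapD _ _ _ _ x sw slb) (drift_lapD _ _ _ _ x sl sb).
      by rewrite (drift_lapZ _ _ _ _ x (smoothX _ 2 su)) (drift_lapZ _ _ _ _ x (smooth_sqdist x0)).
  have qs : 0 <= B * q * sqdist x0 x.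
    by rewrite !mulr_ge0 ?sqdist_ge0 ?invr_ge0 ?sqr_ge0 // ltW.
  have VB : 2 * V * B / (lam * r) <= 2 * V * B * lam.
    have -> : 2 * V * B / (lam * r) = 2 * V * B * (1 / (lam * r)) by rewrite mul1r.
    apply: ler_wpM2l rl; rewrite mulr_ge0 ?mulr_ge0 //; [lra|exact: ltW].
  move: Fx0 qs wx VB (lu0 x0) (lu2 x); rewrite FE mulNr /K.
  move: (tilt2 u x) (tilt2 u x0) (sqdist x0 x) (2 * V * B / _) (lam * u x ^+ 2) (lam * u x0 ^+ 2) => *; lra.
rewrite leNgt; apply/negP => w1.
pose d := tilt2 u x0 - 1.
have d0 : 0 < d by rewrite /d; lra.
pose lam := d / (d + 2 * K + 1).
have D0 : 0 < d + 2 * K + 1 by lra.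
have l0 : 0 < lam by rewrite divr_gt0.
have l1 : lam <= 1 by rewrite ler_pdivrMr //; lra.
have := main lam l0 l1; have : lam * K < d.
  rewrite /lam mulrAC ltr_pdivrMr //.
  have : 0 <= d * K by rewrite mulr_ge0 // ltW.
  have : 0 < d * d by rewrite mulr_gt0.
  lra.
rewrite /d; lra.
Qed.

End Flat.

(** * Entire translators of square root growth *)

Section Horizontal.
Context {R : realType} {n : nat}.
Implicit Types (x q : 'rV[R]_n).
Variable T : 'rV[R]_(n + 1).
Hypothesis hTperp : dotv T (delta_mx 0 (last_coord n)) = 0.

Lemma dotv_pt x (t : R) : dotv (pt x t) T = dotv x (lsubmx T).
Proof.
have TL : T 0 (last_coord n) = 0.
  rewrite -hTperp /dotv (bigD1 (last_coord n)) //= big1 => [|i iN].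
    by rewrite mxE !eqxx mulr1 addr0.
  by rewrite mxE (negbTE iN) andbF mulr0.
rewrite /dotv big_split_ord /= big_ord1 row_mxEr.
have -> : T 0 (rshift n ord0) = 0 by exact: TL.
by rewrite mulr0 addr0; apply: eq_bigr => i _; rewrite row_mxEl mxE.
Qed.

Lemma dotv_horizontal : dotv (lsubmx T) (lsubmx T) = dotv T T.
Proof.
rewrite -(dotv_pt (lsubmx T) (T 0 (last_coord n))); congr (dotv _ T).
apply/rowP => i; rewrite -[RHS]/(T 0 i) -[in RHS](hsubmxK T).
rewrite /pt; case: (split_ordP i) => j ->; first by rewrite !row_mxEl.
by rewrite !row_mxEr !mxE ord1.
Qed.

End Horizontal.

Section Growth.
Context {R : realType} {n : nat}.
Implicit Types (x : 'rV[R]_n).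

Lemma dotv_dist_le x0 x (T : 'rV[R]_n) (s : R) : dotv T T = 1 -> 0 <= s ->
  `|dotv x0 T| <= s ^+ 2 -> sqdist x0 x <= (s ^+ 2) ^+ 2 ->
  Num.sqrt `|dotv x T| <= 2 * s.
Proof.
move=> T1 s0 h0 hx.
have D : `|dotv x T - dotv x0 T| <= s ^+ 2.
  rewrite -(@ler_pXn2r _ 2) ?nnegrE ?sqr_ge0 // real_normK ?num_real //.
  apply: le_trans hx; rewrite /dotv -sumrB.
  rewrite (eq_bigr (fun i => (x 0 i - x0 0 i) * T 0 i)) => [|i _]; last first.
    by rewrite mulrBl.
  apply: le_trans (sum_CauchySchwarz _ _ _ _) _.
  have -> : \sum_i T 0 i ^+ 2 = 1 by rewrite -T1; apply: eq_bigr => i _; rewrite expr2.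
  by rewrite mulr1 sqdistE.
have B : `|dotv x T| <= (2 * s) ^+ 2.
  rewrite -[dotv x T](subrK (dotv x0 T)); apply: le_trans (ler_normD _ _) _.
  apply: le_trans (lerD D h0) _; rewrite exprMn.
  have := sqr_ge0 s; move: (s ^+ 2) => t; lra.
have s20 : 0 <= 2 * s by rewrite mulr_ge0.
by rewrite -[leRHS](ger0_norm s20) -(sqrtr_sqr (2 * s)) ler_wsqrtr.
Qed.

Lemma stationary_invariant (u : 'rV[R]_n -> R) (T : 'rV[R]_n) x (h : R) :
  smooth u -> (forall y, 'D_T u y = 0) -> u (x + h *: T) = u x.
Proof.
move=> su D0; have [c _] := @mvt_line _ _ u x T h (fun y => smooth_derivable u y T su).
by rewrite D0 mulr0 => /eqP; rewrite subr_eq0 => /eqP.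
Qed.

Lemma flat_cst (u : 'rV[R]_n -> R) : smooth u -> (forall x, tilt2 u x <= 1) ->
  forall x, u x = u 0.
Proof.
move=> su H; apply: (smooth_derive0_cst u su) => x v.
rewrite (derive_pderiv u x v su) big1 // => i _.
have S0 : \sum_k pderiv k u x ^+ 2 = 0.
  apply/le_anti; rewrite sumr_ge0 ?andbT => [|k _]; last exact: sqr_ge0.
  by have := H x; rewrite tilt2E gerDl.
have /eqP := S0; rewrite psumr_eq0 => [|k _]; last exact: sqr_ge0.
move/allP => /(_ i (mem_index_enum _)); rewrite implyTb sqrf_eq0 => /eqP ->.
by rewrite mulr0.
Qed.

End Growth.

Theorem theorem1p3 (R : realType) (n : nat) (T : 'rV[R]_(n + 1))
  (u : 'rV[R]_n -> R)
  (hT : enorm T = 1)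
  (hTperp : dotv T (delta_mx 0 (last_coord n)) = 0)
  (hu : entire_graphical_translator T u)
  (hgrowth : exists C1 C2 : R, [/\ 0 < C1, 0 < C2 &
     forall q : 'rV[R]_n,
       `|u q| <= C1 + C2 * Num.sqrt `|dotv (pt q 0) T|]) :
  exists c : R, graph u = horizontal_plane c.
Proof.
have [su eqH] := hu; have [C1 [C2 [C10 C20 hq]]] := hgrowth.
set T' := lsubmx T.
have T1 : dotv T' T' = 1.
  rewrite dotv_horizontal // -(sqr_sqrtr (_ : 0 <= dotv T T)); last first.
    by apply: sumr_ge0 => i _; rewrite -expr2 sqr_ge0.
  by rewrite -/(enorm T) hT expr1n.
have eqT : translator_eq u T'.
  apply/(translator_eqP u su T') => x; rewrite eqH /upward_normal.
  have -> : dotv ((area_density u x)^-1 *: pt (- grad u x) 1) T =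
      (area_density u x)^-1 * dotv (pt (- grad u x) 1) T.
    by rewrite /dotv mulr_sumr; apply: eq_bigr => i _; rewrite mxE mulrA.
  rewrite (dotv_pt T hTperp) /dotv -sumrN; congr (_ * _); apply: eq_bigr => i _.
  by rewrite !mxE mulNr mulrC.
have growth x : `|u x| <= C1 + C2 * Num.sqrt `|dotv x T'|.
  by have := hq x; rewrite dotv_pt.
have [V HV] : exists V, forall x, tilt2 u x <= V.
  apply: (tilt2_bounded u T' su eqT T1 (C1 + 2 * C2)).
    by rewrite addr_gt0 // mulr_gt0.
  move=> x0 x s s1 hx0 hx; have s0 : 0 <= s by exact: le_trans s1.
  apply: le_trans (growth x) _.
  have := dotv_dist_le x0 x T' s T1 s0 hx0 hx; move: (Num.sqrt _) => t ts.
  have h1 : C2 * t <= C2 * (2 * s) by rewrite ler_pM2l.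
  have h2 : C1 * 1 <= C1 * s by rewrite ler_pM2l.
  have H : C1 * 1 <= C1 * s -> C2 * t <= C2 * (2 * s) -> C1 + C2 * t <= (C1 + 2 * C2) * s.
    by clear; lra.
  exact: H.
have DT := translator_stationary u T' su eqT T1 V HV.
have bdd x : `|u x| <= C1.
  rewrite -(stationary_invariant u T' x (- dotv x T') su DT).
  apply: le_trans (growth _) _.
  have -> : dotv (x + - dotv x T' *: T') T' = 0.
    transitivity (dotv x T' - dotv x T' * dotv T' T'); last by rewrite T1 mulr1 subrr.
    rewrite {1 4}/dotv mulr_sumr -sumrB; apply: eq_bigr => i _.
    by rewrite !mxE mulrDl mulNr mulNr mulrA.
  by rewrite normr0 sqrtr0 mulr0 addr0.
have ucst := flat_cst u su (bounded_translator_flat u T' su eqT T1 V C1 HV bdd).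
exists (u 0); apply/seteqP; split=> [p [x _ <-]|p hp].
  by rewrite /horizontal_plane /= /pt row_mxEr mxE ucst.
exists (lsubmx p) => //; rewrite ucst -[RHS](hsubmxK p) /pt; congr row_mx.
by apply/rowP => j; rewrite !mxE ord1; move: hp; rewrite /horizontal_plane /= => <-.
Qed.
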